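(* For every partition $\lambda$, $G^{(\alpha,\beta)}_\lambda(x_1,x_2,\ldots)=\sum_{T\in HT(\lambda)}w_T(\alpha,\beta)\,x^T$.
   Context: Let $\alpha,\beta$ be indeterminates. For a partition $\lambda$ (with $\lambda_j=0$ for $j>\ell(\lambda)$) and $n\ge1$, $G^{(\alpha,\beta)}_\lambda(x_1,\ldots,x_n)=\det\Big[\frac{x_i^{\lambda_j+n-j}(1+\beta x_i)^{j-1}}{(1-\alpha x_i)^{\lambda_j}}\Big]_{1\le i,j\le n}\Big/\prod_{1\le i<j\le n}(x_i-x_j)$; these are stable under $x_{n+1}=0$ and define $G^{(\alpha,\beta)}_\lambda(x_1,x_2,\ldots)$. A hook is a Young diagram $(a\mid b)=(a+1,1^b)$, $a,b\ge0$; $a$ is its arm and $b$ its leg. For tableaux $T_1,T_2$ write $T_1\le T_2$ if $\max(T_1)\le\min(T_2)$ and $T_1<T_2$ if $\max(T_1)<\min(T_2)$. A hook-valued tableau of shape $\lambda$ is a filling of each box of the Young diagram of $\lambda$ (English notation) by a semistandard Young tableau of some hook shape with positive integer entries, such that these hook tableaux weakly increase (for $\le$) from left to right along rows and strictly increase (for $<$) from top to bottom along columns. $HT(\lambda)$ is the set of these. For $T\in HT(\lambda)$, $a(T)$ and $b(T)$ are the sums of arms, respectively legs, of all hooks in $T$, $w_T(\alpha,\beta)=\alpha^{a(T)}\beta^{b(T)}$, and $x^T=\prod_i x_i^{a_i}$ with $a_i$ the total number of occurrences of $i$ in $T$. *)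

(* Defs.v *)
From HB Require Import structures.
From mathcomp Require Import all_boot all_order all_algebra finmap.
From mathcomp Require Import mpoly.
From mathcomp Require Import boolp classical_sets functions cardinality fsbigop.

Set Implicit Arguments.
Unset Strict Implicit.
Unset Printing Implicit Defensive.

Import GRing.Theory.
Local Open Scope ring_scope.

(* R[[x_1, ..., x_n]], a series being its coefficient function on monomials;  *)
(* the variable x_(i+1) is indexed by i : 'I_n.                               *)
Definition fps (n : nat) (R : comNzRingType) : Type := 'X_{1..n} -> R.

HB.instance Definition _ n R := Choice.copy (fps n R) ('X_{1..n} -> R).
HB.instance Definition _ n R := GRing.Zmodule.copy (fps n R) ('X_{1..n} -> R).

Section FpsRing.
Context (n : nat) (R : comNzRingType).
Implicit Types (f g h : fps n R) (m : 'X_{1..n}) (p q : {mpoly R[n]}).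

Definition fpsC (c : R) : fps n R := fun m => if m == 0%MM then c else 0.
Definition fpsX (i : 'I_n) : fps n R := fun m => (m == U_(i)%MM)%:R.

(* Any factorization m = k1 + k2 has both degrees at most mdeg m, so the      *)
(* index type below (the one used by mcoeffM) misses no factorization.        *)
Definition fps_mul f g : fps n R := fun m =>
  \sum_(k : 'X_{1..n < (mdeg m).+1, (mdeg m).+1} | m == (k.1 + k.2)%MM)
     f k.1 * g k.2.

Definition fps_trunc (d : nat) f : {mpoly R[n]} :=
  \sum_(k : 'X_{1..n < d}) f k *: 'X_[k].

Lemma mcoeff_trunc d f m : (mdeg m < d)%N -> (fps_trunc d f)@_m = f m.
Proof.
move=> md; rewrite raddf_sum /= (bigD1 (BMultinom md)) //= mcoeffZ mcoeffX eqxx.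
rewrite mulr1 big1 ?addr0 // => k nk; rewrite mcoeffZ mcoeffX.
case: eqP => [e|]; last by rewrite mulr0.
by case/eqP: nk; apply: val_inj; rewrite /= -e.
Qed.

Lemma fps_mul_mcoeff f g p q m :
    (forall k, (mdeg k <= mdeg m)%N -> p@_k = f k) ->
    (forall k, (mdeg k <= mdeg m)%N -> q@_k = g k) ->
  fps_mul f g m = (p * q)@_m.
Proof.
move=> hp hq; rewrite mcoeffM; apply: eq_bigr => k _.
by rewrite hp ?hq // -ltnS bmdeg.
Qed.

Lemma fps_mul_trunc d f g m :
  (mdeg m < d)%N -> fps_mul f g m = (fps_trunc d f * fps_trunc d g)@_m.
Proof.
by move=> md; apply: fps_mul_mcoeff => k km;
   rewrite mcoeff_trunc // (leq_ltn_trans km).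
Qed.

Lemma fps_mulA : associative fps_mul.
Proof.
move=> f g h; apply/funext => m; pose d := (mdeg m).+1.
rewrite (@fps_mul_mcoeff f _ (fps_trunc d f) (fps_trunc d g * fps_trunc d h)).
- rewrite mulrA -(@fps_mul_mcoeff (fps_mul f g) h) // => k km.
  + by rewrite -fps_mul_trunc.
  + by rewrite mcoeff_trunc.
- by move=> k km; rewrite mcoeff_trunc.
- by move=> k km; rewrite -fps_mul_trunc.
Qed.

Lemma fps_mulC : commutative fps_mul.
Proof.
move=> f g; apply/funext => m.
by rewrite !(@fps_mul_trunc (mdeg m).+1) // mulrC.
Qed.

Lemma fps_mul1 : left_id (fpsC 1) fps_mul.
Proof.
move=> f; apply/funext => m.
rewrite (@fps_mul_mcoeff _ _ 1 (fps_trunc (mdeg m).+1 f)).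
- by rewrite mul1r mcoeff_trunc.
- by move=> k _; rewrite mcoeff1 /fpsC; case: eqP.
- by move=> k km; rewrite mcoeff_trunc.
Qed.

Lemma fps_mulDl : left_distributive fps_mul +%R.
Proof.
move=> f g h; apply/funext => m.
rewrite /fps_mul -[RHS]big_split /=; apply: eq_bigr => k _.
by rewrite -mulrDl.
Qed.

Lemma fps_1_neq0 : fpsC 1 != 0.
Proof.
apply/eqP => /(congr1 (fun f : fps n R => f 0%MM)) /eqP.
by rewrite /fpsC eqxx oner_eq0.
Qed.

HB.instance Definition _ := GRing.Zmodule_isComNzRing.Build (fps n R)
  fps_mulA fps_mulC fps_mul1 fps_mulDl fps_1_neq0.

Definition fps_unit : {pred fps n R} := fun f => `[< exists g, g * f = 1 >].
Definition fps_inv f : fps n R := xget f [set g | g * f = 1].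

Lemma fps_mulVx : {in fps_unit, left_inverse 1 fps_inv *%R}.
Proof. by move=> f /asboolP[g gf]; apply: (@xgetPex _ _ [set g | g * f = 1]); exists g. Qed.

Lemma fps_unitP f g : g * f = 1 -> f \in fps_unit.
Proof. by move=> gf; apply/asboolP; exists g. Qed.

Lemma fps_inv_out : {in [predC fps_unit], fps_inv =1 id}.
Proof.
move=> f nu; rewrite /fps_inv; case: xgetP => // g _ /= gf.
by move: nu; rewrite inE /= (fps_unitP gf).
Qed.

HB.instance Definition _ := GRing.ComNzRing_hasMulInverse.Build (fps n R)
  fps_mulVx fps_unitP fps_inv_out.

(* Exact division, for denominators that are regular but not invertible: the  *)
(* quotient is then unique, and 0 is a junk value when there is none.         *)
Definition fps_exdiv f g : fps n R := xget 0 [set q | q * g = f].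

End FpsRing.

Arguments fpsC {n R} c.
Arguments fpsX {n R} i.

(* Monomials in x_1, x_2, ...: finitely supported exponent functions, again   *)
(* with the variable x_(i+1) indexed by i.                                    *)
Definition imonom := {fsfun nat -> nat with 0%N}.

Definition ifps (R : comNzRingType) : Type := imonom -> R.

HB.instance Definition _ R := Choice.copy (ifps R) (imonom -> R).

Definition imonom_of n (m : 'X_{1..n}) : imonom :=
  [fsfun k in [fset k in iota 0 n]%fset => nth 0%N m k].

(* The specialization x_(n+1) = x_(n+2) = ... = 0.                            *)
Definition ifps_restrict (R : comNzRingType) (n : nat) (F : ifps R) : fps n R :=
  fun m => F (imonom_of m).

Arguments ifps_restrict {R} n F.

Definition ifps_summable (R : comNzRingType) (I : choiceType) (A : set I)
    (F : I -> ifps R) : Prop :=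
  forall m, finite_set [set t | A t /\ F t m != 0].

Definition ifps_sum (R : comNzRingType) (I : choiceType) (A : set I)
    (F : I -> ifps R) : ifps R :=
  fun m => \sum_(t \in A) F t m.

Definition is_partition (la : seq nat) : bool := sorted geq la && (0%N \notin la).

Definition groth_mx (R : comNzRingType) (alpha beta : R) (la : seq nat)
    (n : nat) : 'M[fps n R]_n :=
  \matrix_(i, j)
    (fpsX i ^+ (nth 0%N la j + (n - j.+1)) * (1 + fpsC beta * fpsX i) ^+ j
     / (1 - fpsC alpha * fpsX i) ^+ nth 0%N la j).

Definition grothn (R : comNzRingType) (alpha beta : R) (la : seq nat)
    (n : nat) : fps n R :=
  fps_exdiv (\det (groth_mx alpha beta la n))
    (\prod_(i < n) \prod_(j < n | (i < j)%N) (fpsX i - fpsX j)).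

Arguments grothn {R} alpha beta la n.

(* The determinantal formula is stable only from n = size la on: for smaller  *)
(* n it ignores the last parts of la. A series is determined by these         *)
(* restrictions; the default value of xget is junk.                           *)
Definition groth (R : comNzRingType) (alpha beta : R) (la : seq nat) : ifps R :=
  xget (fun=> 0) [set F : ifps R | forall n : nat, (0 < n)%N ->
    (size la <= n)%N -> ifps_restrict n F = grothn alpha beta la n].

(* A tableau is the sequence of its rows, so its shape is the sequence of row *)
(* lengths.                                                                   *)
Section Tableaux.
Context (T : Type) (le lt : rel T).

Definition above (r1 r2 : seq T) : bool := all2 lt (take (size r2) r1) r2.

Definition semistandard (t : seq (seq T)) : bool :=
  all (sorted le) t && sorted above t.

End Tableaux.

Definition hook_shape (a b : nat) : seq nat := a.+1 :: nseq b 1%N.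

Definition arm (h : seq (seq nat)) : nat := (head 0%N (shape h)).-1.
Definition leg (h : seq (seq nat)) : nat := (size h).-1.

Definition hook_tableau (h : seq (seq nat)) : bool :=
  [&& shape h == hook_shape (arm h) (leg h), semistandard leq ltn h
    & all (leq 1) (flatten h)].

Definition tab_max (h : seq (seq nat)) : nat := (\max_(x <- flatten h) x)%N.
Definition tab_min (h : seq (seq nat)) : nat :=
  foldr minn (head 0%N (flatten h)) (flatten h).

Definition tab_le : rel (seq (seq nat)) :=
  fun h1 h2 => (tab_max h1 <= tab_min h2)%N.
Definition tab_lt : rel (seq (seq nat)) :=
  fun h1 h2 => (tab_max h1 < tab_min h2)%N.

Definition hvtab := seq (seq (seq (seq nat))).

Definition HT (la : seq nat) : set hvtab :=
  [set t | [&& shape t == la, all hook_tableau (flatten t)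
             & semistandard tab_le tab_lt t]].

Definition hv_arm (t : hvtab) : nat := (\sum_(h <- flatten t) arm h)%N.
Definition hv_leg (t : hvtab) : nat := (\sum_(h <- flatten t) leg h)%N.

Definition hv_entries (t : hvtab) : seq nat := flatten (flatten (flatten t)).

Definition hv_monom (t : hvtab) : imonom :=
  [fsfun k in [fset x.-1 | x in hv_entries t]%fset
     => count_mem k.+1 (hv_entries t)].

Definition hv_weight (R : comNzRingType) (alpha beta : R) (t : hvtab) : R :=
  alpha ^+ hv_arm t * beta ^+ hv_leg t.

Definition hv_term (R : comNzRingType) (alpha beta : R) (t : hvtab) : ifps R :=
  fun m => if m == hv_monom t then hv_weight alpha beta t else 0.

(* The indeterminates alpha and beta of Z[alpha, beta].                       *)
Definition Zab : comNzRingType := {mpoly int[2]}.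
Definition alpha : Zab := 'X_0.
Definition beta : Zab := 'X_1.

(* Main.v *)
Require Import Defs.
From mathcomp Require Import all_boot all_order all_algebra perm finmap.
From mathcomp Require Import mpoly.
From mathcomp Require Import boolp classical_sets functions cardinality fsbigop.
From mathcomp Require Import zify ring.

(* With y = x / (1 - alpha x) and t = alpha + beta one has                    *)
(* 1 + t y = (1 + beta x) / (1 - alpha x), so both sides are studied in the   *)
(* variables y_i. Deleting the largest letter k from a hook-valued tableau of *)
(* shape la leaves one of shape mu, where la / mu is a horizontal strip: each *)
(* box of la / mu contained only k's and contributes y_k, and k occurred      *)
(* elsewhere only in the last box of a row i with mu_i > la_(i+1), any number *)
(* of times in the arm and at most once in the leg, contributing 1 + t y_k.   *)
(* The determinants obey the same recursion: summed over mu, the determinant  *)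
(* of size k - 1 factors column by column, and its j-th column times y - z,   *)
(* with z = y_k, telescopes to (1 + t z) f_j(y) - z^(la_j - la_(j+1) + 1)     *)
(* f_(j+1)(y) for the columns f_j of the determinant of size k.               *)

Set Implicit Arguments.
Unset Strict Implicit.
Unset Printing Implicit Defensive.

Import GRing.Theory.
Local Open Scope classical_set_scope.
Local Open Scope ring_scope.

(** * The branching recursion and the determinant *)

(** Both sides are identified, in n variables, with the series [branch n la], which peels off the
    letters n, n - 1, ..., 1: each step sums over the mu interlacing with la, weighting each by the
    one-variable factor [skew_weight].

    On the tableau side, deleting the letter k + 1 is a bijection ([ext_tab_ok], [ext_tab_surj],
    [ext_tab_inj]) onto pairs of a smaller tableau and a record of the deleted letters. The column
    condition turns into interlacing, together with the rule for which boxes may hold extra letters,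
    in [above_ext_row]. The records of one row sum to geometric series, whose value is [row_weight],
    and [has_sum_tab_ok] follows by induction.

    On the determinant side, [branch_det] shows that [branch] times the Vandermonde product in y is
    the determinant in y, by multilinearity ([sum_interlacing_det]), the telescoping sum
    [row_weight_telescope] and the column operations of [det_mx_step]. Substituting y = x / (1 -
    alpha x) multiplies row i by a power of 1 - alpha x_i that also accounts for the change of
    Vandermonde product ([branch_groth_mx]). That product is regular, so the exact quotient is
    [branch] ([grothn_branch]).

    Finally, each monomial involves finitely many variables and receives contributions from finitely
    many tableaux ([hv_term_support]), so the identities in n variables determine the one in
    infinitely many. *)

Definition nat_itv (lo hi : nat) : seq nat := iota lo (hi.+1 - lo).

(* Here b plays the part of la that follows the last one listed.              *)
Fixpoint interlacing (b : nat) (la : seq nat) : seq (seq nat) :=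
  if la is a :: l
  then [seq m :: mu | m <- nat_itv (head b l) a, mu <- interlacing b l]
  else [:: [::]].

Lemma interlacing_cons b a l :
  interlacing b (a :: l) = [seq m :: mu | m <- nat_itv (head b l) a, mu <- interlacing b l].
Proof. by []. Qed.

Section Branching.
Context (A : comNzRingType) (t : A) (y : nat -> A).

(** The boolean exponent tests whether the last of the m remaining boxes has no box of the larger
    shape below it. *)
Definition row_weight (z : A) (hi lo m : nat) : A :=
  z ^+ (hi - m) * (1 + t * z) ^+ (lo < m)%N.

Fixpoint skew_weight (z : A) (b : nat) (la mu : seq nat) : A :=
  match la, mu with
  | a :: l, m :: mu' => row_weight z a (head b l) m * skew_weight z b l mu'
  | _, _ => 1
  end.

Fixpoint branch (k : nat) (la : seq nat) : A :=
  if k is k'.+1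
  then \sum_(mu <- interlacing 0 la) branch k' mu * skew_weight (y k) 0 la mu
  else (all (pred1 0%N) la)%:R.

Lemma mem_nat_itv lo hi m : (m \in nat_itv lo hi) = (lo <= m <= hi)%N.
Proof. by rewrite /nat_itv mem_iota; lia. Qed.

Lemma nat_itv_uniq lo hi : uniq (nat_itv lo hi).
Proof. exact: iota_uniq. Qed.

Lemma mem_interlacingP b la mu : reflect
  (size mu = size la /\
    forall i, (i < size la)%N -> (nth b la i.+1 <= nth 0 mu i <= nth 0 la i)%N)
  (mu \in interlacing b la).
Proof.
elim: la mu => [|a l IHl] mu /=.
  by rewrite inE; apply: (iffP eqP) => [->//|[/size0nil]].
apply: (iffP allpairsP) => [[[m mu'] /= [hm /IHl[sz hmu] ->]]|].
  split=> [/=|[_|i /hmu //]]; first by rewrite sz.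
  by rewrite mem_nat_itv -nth0 in hm.
case: mu => [[]//|m mu [[sz] h]]; exists (m, mu); split=> //=.
  by rewrite mem_nat_itv; apply: (h 0%N).
by apply/IHl; split=> // i il; apply: (h i.+1).
Qed.

Lemma interlacing_uniq b la : uniq (interlacing b la).
Proof.
elim: la => //= a l IHl; apply: allpairs_uniq => //; first exact: nat_itv_uniq.
by case=> [? ?] [? ?] /= _ _ [-> ->].
Qed.

Lemma size_interlacing b la mu : mu \in interlacing b la -> size mu = size la.
Proof. by case/mem_interlacingP. Qed.

(** The last part is the one to split off, because the determinant loses its last row and column. *)
Lemma sum_interlacing_rcons a la (F : seq nat -> A) :
  \sum_(mu <- interlacing 0 (rcons la a)) F mu =
  \sum_(mu <- interlacing a la) \sum_(m <- nat_itv 0 a) F (rcons mu m).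
Proof.
elim: la F => [|c l IHl] F.
  by rewrite interlacing_cons big_allpairs_dep big_seq1 /=; under eq_bigr do rewrite big_seq1.
rewrite rcons_cons !interlacing_cons !big_allpairs_dep.
have -> : head 0%N (rcons l a) = head a l by case: l {IHl}.
by apply: eq_bigr => m _; rewrite IHl.
Qed.

Lemma skew_weight_rcons z a la mu m : size mu = size la ->
  skew_weight z 0 (rcons la a) (rcons mu m) = skew_weight z a la mu * row_weight z a 0 m.
Proof.
elim: la mu => [|c l IHl] [|c' mu] //=; first by rewrite mulr1 mul1r.
move=> [sz]; rewrite IHl // mulrA; congr (row_weight _ _ _ _ * _ * _).
by case: l {IHl sz}.
Qed.

Lemma row_weight_refl z a lo : (a <= lo)%N -> row_weight z a lo a = 1.
Proof. by move=> alo; rewrite /row_weight subnn ltnNge alo mul1r. Qed.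

Lemma branch_rcons0 k la : branch k (rcons la 0) = branch k la.
Proof.
elim: k la => [|k IHk] la /=; first by rewrite all_rcons.
rewrite sum_interlacing_rcons; apply: eq_big_seq => mu /size_interlacing sz.
by rewrite big_seq1 IHk skew_weight_rcons // row_weight_refl // mulr1.
Qed.

(** Interlacing removes at most one nonzero part per letter, so k letters cannot exhaust more than k
    nonzero parts. *)
Lemma branch_eq0 k la : (0 < nth 0 la k)%N -> branch k la = 0.
Proof.
elim: k la => [|k IHk] la /=; first by case: la => //= -[].
move=> hk; rewrite big1_seq // => mu /= /mem_interlacingP[sz h].
rewrite IHk ?mul0r //; have kl : (k < size la)%N.
  by rewrite ltnNge; apply: contraL hk => kl; rewrite nth_default // (leq_trans kl).
by case/andP: (h _ kl) => h1 _; apply: leq_trans h1.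
Qed.

(** The parts of mu range independently over intervals. *)
Lemma sum_interlacing_prod b la (F : nat -> nat -> A) :
  \sum_(mu <- interlacing b la) \prod_(j < size la) F j (nth 0%N mu j) =
  \prod_(j < size la) \sum_(m <- nat_itv (nth b la j.+1) (nth 0%N la j)) F j m.
Proof.
elim: la F => [|a l IHl] F; first by rewrite big_seq1 !big_ord0.
rewrite interlacing_cons big_allpairs_dep big_ord_recl /= nth0 mulr_suml; apply: eq_bigr => m _.
rewrite -(IHl (fun j => F j.+1)) mulr_sumr; apply: eq_bigr => mu _.
by rewrite big_ord_recl.
Qed.

Lemma skew_weightE z b la mu : size mu = size la ->
  skew_weight z b la mu = \prod_(j < size la)
    row_weight z (nth 0%N la j) (nth b la j.+1) (nth 0%N mu j).
Proof.
elim: la mu => [|a l IHl] [|m mu] //=; first by rewrite big_ord0.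
by move=> [sz]; rewrite big_ord_recl /= nth0 IHl.
Qed.

(** * Telescoping and determinants in the variables y *)

Definition det_entry (n : nat) (la : seq nat) (j : nat) (w : A) : A :=
  w ^+ (nth 0%N la j + (n - j.+1)) * (1 + t * w) ^+ j.

(** Induction on hi - lo: raising hi by one multiplies the old terms by z and adds a top term, which
    carries the factor 1 + t z. *)
Lemma row_weight_telescope z w lo hi : (lo <= hi)%N ->
  (w - z) * (\sum_(m <- nat_itv lo hi) w ^+ m * row_weight z hi lo m) =
  (1 + t * z) * w ^+ hi.+1 - z ^+ (hi - lo).+1 * w ^+ lo * (1 + t * w).
Proof.
move=> /subnKC <-; rewrite addKn; elim: (hi - lo)%N => {hi} [|e IHe].
  rewrite addn0 /nat_itv subSnn big_seq1 /row_weight subnn ltnn !expr0 !exprS; ring.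
rewrite addnS /nat_itv subSn ?leqW ?leq_addr // -[(_ - lo).+1]addn1 iotaD.
rewrite big_cat big_seq1 /=.
have -> : (lo + ((lo + e).+1 - lo) = (lo + e).+1)%N by rewrite subnKC ?leqW ?leq_addr.
rewrite {2}/row_weight subnn ltnS leq_addr expr0 expr1 mul1r.
under eq_big_seq => m.
  rewrite mem_iota => mm; have me : (m <= lo + e)%N by lia.
  have -> : w ^+ m * row_weight z (lo + e).+1 lo m = z * (w ^+ m * row_weight z (lo + e) lo m).
    by rewrite /row_weight subSn // exprS; ring.
  over.
rewrite -mulr_sumr mulrDr mulrCA IHe !exprS; ring.
Qed.

Lemma det_scale_row n (B : 'M[A]_n) (a : 'I_n -> A) :
  \det (\matrix_(i, j) (a i * B i j)) = (\prod_i a i) * \det B.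
Proof.
have -> : \matrix_(i, j) (a i * B i j) = diag_mx (\row_i a i) *m B.
  by apply/matrixP => i j; rewrite mul_diag_mx !mxE.
by rewrite det_mulmx det_diag; congr (_ * _); apply: eq_bigr => i _; rewrite mxE.
Qed.

Lemma det_scale_col n (B : 'M[A]_n) (c : 'I_n -> A) :
  \det (\matrix_(i, j) (B i j * c j)) = \det B * \prod_i c i.
Proof.
have -> : \matrix_(i, j) (B i j * c j) = B *m diag_mx (\row_i c i).
  by apply/matrixP => i j; rewrite mul_mx_diag !mxE.
by rewrite det_mulmx det_diag; congr (_ * _); apply: eq_bigr => i _; rewrite mxE.
Qed.

(** Column j depends on mu only through its j-th part, so each product in the Leibniz expansion can
    be summed factor by factor. *)
Lemma sum_interlacing_det n b la (F : 'I_n -> 'I_n -> nat -> A) : size la = n ->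
  \sum_(mu <- interlacing b la) \det (\matrix_(i, j) F i j (nth 0%N mu j)) =
  \det (\matrix_(i, j)
     \sum_(m <- nat_itv (nth b la j.+1) (nth 0%N la j)) F i j m).
Proof.
move=> sz; rewrite -det_tr; under eq_bigr do rewrite -det_tr.
rewrite exchange_big /=; apply: eq_bigr => s _; rewrite -mulr_sumr; congr (_ * _).
(* [G] extends the factors to all natural indices, as [sum_interlacing_prod] expects; its value 0
   outside the range is never reached. *)
pose G j m := if insub j is Some i then F (s i) i m else 0.
have GE (i : 'I_n) m : G i m = F (s i) i m by rewrite /G valK.
transitivity (\sum_(mu <- interlacing b la) \prod_(j < n) G j (nth 0%N mu j)).
  by apply: eq_bigr => mu _; apply: eq_bigr => j _; rewrite GE !mxE.
have := sum_interlacing_prod b la G; rewrite sz => ->; apply: eq_bigr => j _; rewrite !mxE.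
by apply: eq_bigr => m _; rewrite GE.
Qed.

Definition vandermonde (n : nat) (x : nat -> A) : A :=
  \prod_(i < n) \prod_(j < n | (i < j)%N) (x i - x j).

Lemma vandermondeS n x : vandermonde n.+1 x =
  vandermonde n x * \prod_(i < n) (x i - x n).
Proof.
rewrite /vandermonde big_ord_recr /= [X in _ * X]big1 ?mulr1; last first.
  by move=> j; rewrite ltnNge -ltnS ltn_ord.
rewrite -big_split; apply: eq_bigr => i _ /=.
rewrite big_mkcond big_ord_recr /= ltn_ord; congr (_ * _).
by rewrite -big_mkcond.
Qed.

Definition det_mx n la : 'M[A]_n := \matrix_(i, j) det_entry n la j (y i.+1).

Definition comb_col n la j (z w : A) : A :=
  (1 + t * z) * det_entry n la j w -
  z ^+ (nth 0%N la j - nth 0%N la j.+1).+1 * det_entry n la j.+1 w.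

(** At w = z both terms equal z^(la_j + n - j) (1 + t z)^(j + 1). *)
Lemma comb_col_diag n la j z : (j < n)%N -> (nth 0%N la j.+1 <= nth 0%N la j)%N ->
  comb_col n.+1 la j z z = 0.
Proof.
move=> jn le; apply/eqP; rewrite subr_eq0 /det_entry; apply/eqP.
set a := nth _ _ j in le *; set b := nth _ _ _ in le *.
rewrite -(subnK le) addnK -addnA subSS.
rewrite (_ : n - j = (n.+1 - j.+2).+1)%N; last by lia.
move: (a - b)%N (n.+1 - _)%N => u v; rewrite addnS !(exprD, exprS); ring.
Qed.

(* The columns of [det_mx] are combined so that its last row vanishes except  *)
(* in the corner.                                                             *)
Lemma det_mx_step n la : sorted geq la -> size la = n.+1 ->
  \det (det_mx n.+1 la) * (1 + t * y n.+1) ^+ n =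
  y n.+1 ^+ nth 0%N la n * (1 + t * y n.+1) ^+ n *
  \det (\matrix_(i < n, j < n) comb_col n.+1 la j (y n.+1) (y i.+1)).
Proof.
move=> sla sz; set z := y n.+1.
have lela j : (nth 0%N la j.+1 <= nth 0%N la j)%N.
  have [jl|jl] := ltnP j.+1 (size la); last by rewrite nth_default.
  by move/(sortedP 0%N): sla => /(_ j jl).
pose c1 (j : nat) := if (j < n)%N then 1 + t * z else 1.
pose c2 (j : nat) : A := if (j < n)%N
  then - z ^+ (nth 0%N la j - nth 0%N la j.+1).+1 else 0.
pose C : 'M[A]_n.+1 := \matrix_(i, j)
  (* [C] is lower bidiagonal, with diagonal entries 1 + t z except for a 1 in the last corner; hence
     its determinant is (1 + t z)^n. *)
  (c1 j *+ (i == j) + c2 j *+ (i == j.+1 :> nat)).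
pose B : 'M[A]_n.+1 := \matrix_(i, j) if (j < n)%N
  then comb_col n.+1 la j z (y i.+1) else det_entry n.+1 la j (y i.+1).
have detC : \det C = (1 + t * z) ^+ n.
  rewrite det_trig; last first.
    apply/is_trig_mxP => i j ij; rewrite mxE -val_eqE /= !(ltn_eqF _) //.
      by rewrite addr0.
    exact: ltnW.
  rewrite big_ord_recr /= mxE eqxx /c1 /c2 ltnn mul0rn addr0 mulr1.
  rewrite -[n in RHS]card_ord -prodr_const; apply: eq_bigr => i _.
  by rewrite mxE eqxx /c1 /c2 /= ltn_ord (ltn_eqF (ltnSn i)) addr0.
have MC : det_mx n.+1 la *m C = B.
  apply/matrixP => i j; rewrite !mxE.
  under eq_bigr => k _ do rewrite !mxE mulrDr !mulrnAr.
  rewrite big_split /= (bigD1 j) //= eqxx mulr1n [X in _ + X + _]big1 ?addr0.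
    2: by move=> k /negPf->; rewrite mulr0n.
  rewrite /c1 /c2; case: ltnP => jn; last first.
    rewrite mulr1 big1 ?addr0 // => k _; rewrite mulr0 mul0rn //.
  have jn' : (j.+1 < n.+1)%N by [].
  rewrite (bigD1 (Ordinal jn')) //= eqxx mulr1n big1 ?addr0 => [|k]; last first.
    by rewrite -val_eqE /= => /negPf->; rewrite mulr0n.
  by rewrite /comb_col /=; ring.
rewrite -detC -det_mulmx MC (expand_det_row _ ord_max) big_ord_recr /=.
rewrite big1 ?add0r => [|j _]; last first.
  by rewrite mxE /= ltn_ord comb_col_diag ?mul0r.
rewrite mxE ltnn detC /det_entry subnn addn0 /= -/z; congr (_ * _).
rewrite /cofactor addnn -signr_odd odd_double expr0 mul1r; congr (\det _).
apply/matrixP => i j; rewrite !mxE /= /bump (leqNgt n i) (leqNgt n j) !ltn_ord.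
by rewrite !add0n.
Qed.

(** With n letters left, the last of the n + 1 parts of mu must be 0 by [branch_eq0], so the whole
    last row is removed and contributes y^a. *)
Lemma branchS_rcons n l a : size l = n ->
  branch n.+1 (rcons l a) =
  y n.+1 ^+ a * \sum_(mu <- interlacing a l) branch n mu * skew_weight (y n.+1) a l mu.
Proof.
move=> sz; rewrite /= sum_interlacing_rcons mulr_sumr; apply: eq_big_seq => mu.
move/size_interlacing => szm; rewrite /nat_itv subn0 big_cons.
rewrite big1_seq ?addr0 => [|m]; last first.
  rewrite mem_iota => /andP[_ /andP[m0 _]]; rewrite branch_eq0 ?mul0r //.
  by rewrite nth_rcons szm sz ltnn eqxx.
rewrite branch_rcons0 skew_weight_rcons // /row_weight subn0 ltnn expr0; ring.
Qed.

Lemma interlacing_sorted b la mu : mu \in interlacing b la -> sorted geq mu.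
Proof.
case/mem_interlacingP => sz h; apply/(sortedP 0%N) => i; rewrite sz => il.
have := h i (ltnW il); have := h i.+1 il.
rewrite (set_nth_default 0%N b il) //= => /andP[_ h1] /andP[h2 _].
exact: leq_trans h2.
Qed.

(** [det_mx_step] determines the determinant only up to a power of 1 + t y, which regularity allows
    to cancel. *)
Theorem branch_det n la : (forall c, GRing.lreg (1 + t * y c)) ->
  size la = n -> sorted geq la ->
  branch n la * vandermonde n (fun i => y i.+1) = \det (det_mx n la).
Proof.
move=> reg; elim: n la => [|n IHn] la sz sla.
  by rewrite (size0nil sz) /vandermonde big_ord0 det_mx00 mulr1.
have lr : GRing.lreg ((1 + t * y n.+1) ^+ n) by apply: lregX.
apply: lr; rewrite [RHS]mulrC det_mx_step // mulrAC mulrC; congr (_ * _).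
case/lastP: la sz sla => // l a; rewrite size_rcons => -[sz] sla.
rewrite branchS_rcons // nth_rcons sz ltnn eqxx -mulrA; congr (_ * _).
rewrite vandermondeS mulrA mulr_suml.
have -> : \sum_(mu <- interlacing a l) branch n mu * skew_weight (y n.+1) a l mu *
       vandermonde n (fun i => y i.+1) =
    \sum_(mu <- interlacing a l) \det (\matrix_(i < n, j < n)
      (det_entry n mu j (y i.+1) *
       row_weight (y n.+1) (nth 0%N l j) (nth a l j.+1) (nth 0%N mu j))).
  apply: eq_big_seq => mu mul; have szm := size_interlacing mul.
  rewrite mulrAC IHn; [|by rewrite szm|exact: interlacing_sorted mul].
  have := skew_weightE (y n.+1) a szm; rewrite sz => ->.
  rewrite -det_scale_col; congr (\det _); apply/matrixP => i j; by rewrite !mxE.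
rewrite (sum_interlacing_det _ (fun i j m => (y i.+1 ^+ (m + (n - j.+1)) *
  (1 + t * y i.+1) ^+ j) * row_weight (y n.+1) (nth 0%N l j) (nth a l j.+1) m)) //.
(* The factors y_i - y_(n+1) of the larger Vandermonde product go one to each row, so that every
   entry becomes a telescoping sum. *)
rewrite mulrC -det_scale_row; congr (\det _); apply/matrixP => i j; rewrite !mxE.
have jl : (j < size l)%N by rewrite sz.
have nj1 : nth 0%N (rcons l a) j.+1 = nth a l j.+1.
  rewrite nth_rcons; case: ltngtP => // jl1; first exact: set_nth_default.
    by lia.
  by rewrite nth_default ?jl1.
have nj : nth 0%N (rcons l a) j = nth 0%N l j by rewrite nth_rcons jl.
rewrite /comb_col /det_entry nj nj1.
have le : (nth a l j.+1 <= nth 0%N l j)%N.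
  rewrite -nj -nj1; move/(sortedP 0%N): sla; apply.
  by rewrite size_rcons ltnS.
have := row_weight_telescope (y n.+1) (y i.+1) le.
move: (nth a l _) (nth 0%N l _) le => lo hi le.
have -> : \sum_(m <- nat_itv lo hi) y i.+1 ^+ (m + (n - j.+1)) * (1 + t * y i.+1) ^+ j *
      row_weight (y n.+1) hi lo m =
    y i.+1 ^+ (n - j.+1) * (1 + t * y i.+1) ^+ j *
      \sum_(m <- nat_itv lo hi) y i.+1 ^+ m * row_weight (y n.+1) hi lo m.
  by rewrite mulr_sumr; apply: eq_bigr => m _; rewrite exprD; ring.
rewrite mulrCA => ->; rewrite subSS (_ : n - j = (n - j.+1).+1)%N; last first.
  by have := ltn_ord j; lia.
rewrite addnS !(exprD, exprS); ring.
Qed.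

End Branching.

(** * From the variables y back to the variables x *)

Lemma branch_pad (A : comNzRingType) (t : A) y k la p :
  branch t y k (la ++ nseq p 0%N) = branch t y k la.
Proof.
elim: p => [|p IHp]; first by rewrite cats0.
by rewrite -addn1 nseqD catA cats1 branch_rcons0.
Qed.

(** Each index lies in n - 1 of the pairs. It is applied with u_i = 1 - alpha x_i, for which y_i -
    y_j = (x_i - x_j) / (u_i u_j). *)
Lemma vandermonde_scale (A : comNzRingType) (x y u : nat -> A) n :
  (forall i j, (y i - y j) * (u i * u j) = x i - x j) ->
  vandermonde n y * \prod_(i < n) u i ^+ n.-1 = vandermonde n x.
Proof.
move=> h; elim: n => [|[|n] IHn]; first by rewrite /vandermonde !big_ord0 mulr1.
  by rewrite !vandermondeS /vandermonde big_ord1 !big_ord0 !mulr1.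
rewrite !(vandermondeS n.+1) -IHn [\prod_(i < n.+2) _]big_ord_recr /=.
have -> : u n.+1 ^+ n.+1 = \prod_(i < n.+1) u n.+1 by rewrite prodr_const card_ord.
rewrite -!mulrA; congr (_ * _).
rewrite mulrCA -!big_split /=; apply: eq_bigr => i _.
by rewrite -h exprSr; ring.
Qed.

Section Entries.
Context (B : comUnitRingType) (al be x : B).
Hypothesis u_unit : 1 - al * x \is a GRing.unit.

Lemma one_addM_div : 1 + (al + be) * (x / (1 - al * x)) = (1 + be * x) / (1 - al * x).
Proof.
apply: (mulIr u_unit); rewrite divrK // mulrDl mul1r mulrA divrK //; ring.
Qed.

(** In terms of x the right-hand entry has denominator exponent la_j + (n - j - 1) + j, which
    exceeds la_j by n - 1 for every j. The correction is therefore a factor of the whole row. *)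
Lemma det_entry_div n la j : (j < n)%N ->
  x ^+ (nth 0%N la j + (n - j.+1)) * (1 + be * x) ^+ j / (1 - al * x) ^+ nth 0%N la j =
  (1 - al * x) ^+ n.-1 * det_entry (al + be) n la j (x / (1 - al * x)).
Proof.
move=> jn; rewrite /det_entry one_addM_div !exprMn !exprVn.
have -> : n.-1 = (n - j.+1 + j)%N by lia.
move: u_unit; set u := 1 - al * x; move: (nth _ _ _) (n - _)%N => a b uu.
apply: (mulIr (unitrX a uu)); rewrite divrK ?unitrX // [in u ^- (a + b)]exprD.
rewrite invrM ?unitrX //.
have uV c : u ^+ c * u ^- c = 1 by rewrite mulrV ?unitrX.
transitivity (x ^+ (a + b) * (1 + be * x) ^+ j * (u ^+ a * u ^- a) *
    (u ^+ b * u ^- b) * (u ^+ j * u ^- j)).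
  by rewrite !uV !mulr1.
by rewrite [u ^+ (b + j)]exprD; ring.
Qed.

End Entries.

(** * Summable families of power series *)

Section FpsSums.
Context (n : nat) (R : comNzRingType).
Implicit Types (f g h : fps n R) (m : 'X_{1..n}).

Definition eq_below (d : nat) f g := forall m, (mdeg m < d)%N -> f m = g m.

Lemma fpsDE f g m : (f + g) m = f m + g m. Proof. by []. Qed.
Lemma fpsNE f m : (- f) m = - f m. Proof. by []. Qed.
Lemma fps1E m : (1 : fps n R) m = (m == 0%MM)%:R.
Proof. by rewrite {1}/GRing.one /= /fpsC; case: eqP. Qed.

Lemma fpsME f g m : (f * g) m =
  \sum_(k : 'X_{1..n < (mdeg m).+1, (mdeg m).+1} | m == (k.1 + k.2)%MM)
     f k.1 * g k.2.
Proof. by []. Qed.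

Lemma fps_sumE (I : Type) (s : seq I) (F : I -> fps n R) m :
  (\sum_(t <- s) F t) m = \sum_(t <- s) F t m.
Proof. by elim/big_rec2: _ => // t _ y _ <-. Qed.

Lemma eq_below_mul d f f' g g' : eq_below d f f' -> eq_below d g g' ->
  eq_below d (f * g) (f' * g').
Proof.
move=> ef eg m md; rewrite !fpsME; apply: eq_bigr => k _.
by rewrite ef ?eg // (leq_trans (bmdeg _)).
Qed.

Lemma eq_below_eq f g : (forall d, eq_below d f g) -> f = g.
Proof. by move=> e; apply/funext => m; apply: (e (mdeg m).+1). Qed.

(** Without a constant term, each further factor raises the least degree by at least one. *)
Lemma eq_below_exp d f : f 0%MM = 0 -> eq_below d (f ^+ d) 0.
Proof.
move=> f0; elim: d => [|d IHd] m // md.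
have deg (a b : 'X_{1..n}) : m = (a + b)%MM -> a != 0%MM -> (mdeg b < d)%N.
  by move=> e; rewrite -mdeg_eq0; move: md; rewrite e mdegD; lia.
rewrite exprS fpsME big1 // => k /eqP mk.
have [k0|kn0] := eqVneq (bmnm k.1) 0%MM; first by rewrite k0 f0 mul0r.
rewrite IHd ?mulr0 //; apply: deg mk kn0.
Qed.

Lemma eq_below_expW d e f : f 0%MM = 0 -> (d <= e)%N -> eq_below d (f ^+ e) 0.
Proof. by move=> f0 de m md; rewrite eq_below_exp // (leq_trans md). Qed.

(** By [eq_below_exp] the powers beyond [mdeg m] leave the coefficient of m unchanged, so the
    partial sums stabilize; the finite identity [subrX1] shows that their limit inverts 1 - f. *)
Lemma eq_below_geom f : f 0%MM = 0 ->
  exists2 g, g * (1 - f) = 1 & forall d, eq_below d (\sum_(i <- iota 0 d) f ^+ i) g.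
Proof.
move=> f0; pose g : fps n R := fun m => (\sum_(i <- iota 0 (mdeg m).+1) f ^+ i) m.
have eg d : eq_below d (\sum_(i <- iota 0 d) f ^+ i) g.
  move=> m md; rewrite /g -(subnKC md) iotaD big_cat /= fpsDE -[RHS]addr0.
  congr (_ + _); rewrite fps_sumE big1_seq // => i /andP[_].
  by rewrite mem_iota => /andP[im _]; rewrite (@eq_below_expW (mdeg m).+1).
exists g => //; apply: eq_below_eq => d m md.
have <- := @eq_below_mul d _ _ (1 - f) _ (eg d) (fun _ _ => erefl) m md.
have := subrX1 f d; rewrite -(big_mkord xpredT (fun i => f ^+ i)).
rewrite /index_iota subn0 => e; rewrite -opprB mulrN mulrC -e opprB fpsDE fpsNE.
by rewrite eq_below_exp // oppr0 addr0.
Qed.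

Lemma fps_unit_1B f : f 0%MM = 0 -> 1 - f \is a GRing.unit.
Proof. by move=> /eq_below_geom[g gf _]; apply/unitrPr; exists g; rewrite mulrC. Qed.

(* Lists are taken modulo degree d so that products of sums need no           *)
(* rearrangement of infinite sums.                                            *)
Definition has_sum (I : eqType) (A : I -> Prop) (F : I -> fps n R) (S : fps n R) :=
  forall d, exists s : seq I,
    [/\ uniq s, forall t, t \in s -> A t,
        forall t, A t -> t \notin s -> eq_below d (F t) 0
      & eq_below d (\sum_(t <- s) F t) S].

Lemma has_sum_geom f : f 0%MM = 0 ->
  has_sum (fun _ : nat => True) (fun i => f ^+ i) (1 - f)^-1.
Proof.
move=> f0 d; exists (iota 0 d); split; rewrite ?iota_uniq //.
  by move=> t _; rewrite mem_iota /= add0n -leqNgt => dt; apply: eq_below_expW.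
have [g gf eg] := eq_below_geom f0.
have -> // : (1 - f)^-1 = g.
by apply: (mulIr (fps_unit_1B f0)); rewrite mulVr ?fps_unit_1B // gf.
Qed.

Lemma has_sum_seq (I : eqType) (s : seq I) (F : I -> fps n R) : uniq s ->
  has_sum (fun t => t \in s) F (\sum_(t <- s) F t).
Proof. by move=> us d; exists s; split=> // t ->. Qed.

Lemma has_sum_bij (I J : eqType) (A : I -> Prop) (B : J -> Prop) F G S (phi : I -> J) :
    (forall t, A t -> B (phi t)) ->
    (forall t u, A t -> A u -> phi t = phi u -> t = u) ->
    (forall u, B u -> exists2 t, A t & u = phi t) ->
    (forall t, A t -> G (phi t) = F t) ->
  has_sum A F S -> has_sum B G S.
Proof.
move=> AB inj surj GF hA d; have [s [us sA As eS]] := hA d.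
exists (map phi s); split.
- rewrite map_inj_in_uniq // => t u ts uu; apply: inj; exact: sA.
- by move=> _ /mapP[t ts ->]; apply/AB/sA.
- move=> _ /surj[t At ->] tn; rewrite GF //; apply: As => //.
  by apply: contra tn => ts; apply: map_f.
- by rewrite big_map (eq_big_seq F) // => t ts; rewrite GF //; apply: sA.
Qed.

Lemma has_sum_ext (I : eqType) (A B : I -> Prop) F G S :
    (forall t, A t <-> B t) -> (forall t, A t -> G t = F t) ->
  has_sum A F S -> has_sum B G S.
Proof.
move=> AB GF; apply: (@has_sum_bij _ _ _ _ _ _ _ id) => // [t /AB //|u Bu].
by exists u => //; apply/AB.
Qed.

(** A pair outside the product of the two lists has a factor that vanishes below degree d. *)
Lemma has_sum_prod (I J : eqType) (A : I -> Prop) (B : J -> Prop) F G S S' :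
  has_sum A F S -> has_sum B G S' ->
  has_sum (fun t : I * J => A t.1 /\ B t.2) (fun t => F t.1 * G t.2) (S * S').
Proof.
move=> hA hB d; have [s [us sA As eS]] := hA d; have [s' [us' sB Bs eS']] := hB d.
exists [seq (t, u) | t <- s, u <- s']; split.
- by apply: allpairs_uniq => // -[? ?] [? ?].
- by move=> _ /allpairsP[[t u] /= [ts uu ->]]; split; [apply: sA|apply: sB].
- move=> [t u] /= [At Bu]; have [ts|ts _] := boolP (t \in s).
    have [uu|uu _] := boolP (u \in s').
      by case/negP; apply/allpairsP; exists (t, u).
    by rewrite -(mulr0 (F t)); apply: eq_below_mul => //; apply: Bs.
  by rewrite -(mul0r (G u)); apply: eq_below_mul => //; apply: As.
- rewrite big_allpairs /=; under eq_bigr do rewrite -mulr_sumr.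
  by rewrite -mulr_suml; apply: eq_below_mul.
Qed.

Lemma has_sum_partition (I J : eqType) (A : I -> Prop) F (phi : I -> J) (s : seq J) S :
    uniq s -> (forall t, A t -> phi t \in s) ->
    (forall j, j \in s -> has_sum (fun t => A t /\ phi t = j) F (S j)) ->
  has_sum A F (\sum_(j <- s) S j).
Proof.
move=> us As hS d.
(* The claim is restricted to the fibres over [s], so that it goes through by induction on [s]. *)
suff [l [ul lA Al el]] : exists l : seq I, [/\ uniq l,
   forall t, t \in l -> A t /\ phi t \in s,
   forall t, A t -> phi t \in s -> t \notin l -> eq_below d (F t) 0
   & eq_below d (\sum_(t <- l) F t) (\sum_(j <- s) S j)].
  by exists l; split=> // [t /lA[]|t At]//; apply: Al => //; apply: As.
elim: s us hS {As} => [_ _|j s IHs /= /andP[js us] hS].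
  by exists [::]; split => //; rewrite !big_nil.
have [||l [ul lA Al el]] := IHs => //.
  by move=> i si; apply: hS; rewrite inE si orbT.
have [l' [ul' lA' Al' el']] := hS j (mem_head _ _) d.
exists (l' ++ l); split.
- rewrite cat_uniq ul ul' andbT; apply/hasPn => t /lA[_ ts].
  by apply: contra js => /lA'[_ <-].
- move=> t; rewrite mem_cat => /orP[/lA'[At <-]|/lA[At ts]].
    by rewrite inE eqxx.
  by rewrite inE ts orbT.
- move=> t At; rewrite inE mem_cat negb_or => /orP[/eqP tj|ts] /andP[tl' tl].
    exact: Al'.
  exact: Al.
- by move=> m md; rewrite big_cat big_cons /= !fpsDE el' ?el.
Qed.

End FpsSums.

(** * Deleting the largest letter of a hook-valued tableau *)

Section HookValued.
Local Open Scope nat_scope.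

(** * Single hooks *)

Definition mkhook (x : nat) (r l : seq nat) : seq (seq nat) :=
  (x :: r) :: [seq [:: c] | c <- l].

Lemma flatten_mkhook x r l : flatten (mkhook x r l) = x :: r ++ l.
Proof. by rewrite /mkhook /= flatten_seq1. Qed.

Lemma arm_mkhook x r l : arm (mkhook x r l) = size r.
Proof. by []. Qed.

Lemma leg_mkhook x r l : leg (mkhook x r l) = size l.
Proof. by rewrite /leg /= size_map. Qed.

Lemma shape_seq1 (l : seq nat) : shape [seq [:: c] | c <- l] = nseq (size l) 1.
Proof. by elim: l => //= c l ->. Qed.

Lemma above_hook x r l : path (above ltn) (x :: r) [seq [:: c] | c <- l] = path ltn x l.
Proof.
by elim: l x r => //= c l IHl x r; rewrite IHl {1}/above /= take0 /= andbT.
Qed.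

Lemma path_leq_all x r : path leq x r -> all (leq x) r.
Proof. exact: order_path_min leq_trans. Qed.

Lemma path_ltn_leq x l : path ltn x l -> path leq x l.
Proof. by apply: sub_path => a b /ltnW. Qed.

Lemma hookP h : reflect
  (exists x r l, [/\ h = mkhook x r l, path leq x r, path ltn x l & 0 < x])
  (hook_tableau h).
Proof.
apply: (iffP and3P) => [[]|[x [r [l [-> pr pl x0]]]]].
  case: h => [|[|x r] h] //; rewrite /arm /leg /= => /eqP[sh].
  have {sh} : exists l, h = [seq [:: c] | c <- l].
    elim: h sh => [_|[|c [|? ?]] h IHh] //=; first by exists [::].
    by case=> /IHh[l ->]; exists (c :: l).
  move=> [l ->]; rewrite /semistandard /= above_hook => /andP[/andP[pr _] pl] /andP[x0 _].
  by exists x, r, l.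
split; first by rewrite arm_mkhook leg_mkhook /= shape_seq1.
  rewrite /semistandard /= pr above_hook pl andbT.
  by apply/allP => _ /mapP[c _ ->].
rewrite flatten_mkhook /= x0 /= all_cat.
apply/andP; split; [move: (path_leq_all pr)|move: (path_leq_all (path_ltn_leq pl))];
  by apply: sub_all => c; apply: leq_trans.
Qed.

Lemma tab_min_mkhook x r l : path leq x r -> path ltn x l ->
  tab_min (mkhook x r l) = x.
Proof.
move=> pr pl; rewrite /tab_min flatten_mkhook /= -[RHS](minnn x); congr minn.
have : all (leq x) (r ++ l).
  by rewrite all_cat !path_leq_all // path_ltn_leq.
by elim: (r ++ l) => //= c s IHs /andP[xc /IHs ->]; apply/minn_idPr.
Qed.

Definition bounded (k : nat) (h : seq (seq nat)) : bool := all (leq^~ k) (flatten h).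

Lemma tab_max_leq h k : (tab_max h <= k) = bounded k h.
Proof.
by apply/bigmax_leqP_seq/allP => [H x xh|H x xh _]; apply: H.
Qed.

Definition hookb k h := hook_tableau h && bounded k h.

Lemma bounded_mkhook k x r l :
  bounded k (mkhook x r l) = [&& x <= k, all (leq^~ k) r & all (leq^~ k) l].
Proof. by rewrite /bounded flatten_mkhook /= all_cat. Qed.

Lemma hookbP k h : reflect
  (exists x r l, [/\ h = mkhook x r l, path leq x r, path ltn x l, 0 < x &
                     [&& x <= k, all (leq^~ k) r & all (leq^~ k) l]])
  (hookb k h).
Proof.
apply: (iffP andP) => [[/hookP[x [r [l [-> pr pl x0]]]]]|].
  by rewrite bounded_mkhook => b; exists x, r, l.
move=> [x [r [l [-> pr pl x0 b]]]]; rewrite bounded_mkhook b; split=> //.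
by apply/hookP; exists x, r, l.
Qed.

Lemma hookb_tab_min k h : hookb k h -> tab_min h <= k.
Proof.
by case/hookbP=> x [r [l [-> pr pl _ /and3P[xk _ _]]]]; rewrite tab_min_mkhook.
Qed.

Lemma hookb_tab_max k h : hookb k h -> tab_max h <= k.
Proof. by case/andP; rewrite tab_max_leq. Qed.

Lemma hookb_min_le_max k h : hookb k h -> tab_min h <= tab_max h.
Proof.
case/hookbP=> x [r [l [-> pr pl _ _]]]; rewrite tab_min_mkhook //.
have := leqnn (tab_max (mkhook x r l)).
by rewrite {1}tab_max_leq bounded_mkhook => /andP[].
Qed.

Lemma hookbW k k' h : k <= k' -> hookb k h -> hookb k' h.
Proof.
by move=> kk /andP[? b]; apply/andP; split=> //; apply: sub_all b => x /leq_trans; apply.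
Qed.

Lemma hookbS k h : hookb k.+1 h -> tab_max h <= k -> hookb k h.
Proof. by rewrite tab_max_leq => /andP[hh _] b; apply/andP. Qed.

(** [q] is a boolean because a leg is strictly increasing and so holds the largest letter at most
    once. *)
Definition add_hook (z p : nat) (q : bool) (h : seq (seq nat)) : seq (seq nat) :=
  (head [::] h ++ nseq p z) :: (behead h ++ nseq q [:: z]).

Lemma add_hook_mkhook z p q x r l :
  add_hook z p q (mkhook x r l) = mkhook x (r ++ nseq p z) (l ++ nseq q z).
Proof. by rewrite /add_hook /mkhook /= map_cat map_nseq. Qed.

Lemma add_hook00 k h : hookb k h -> add_hook k.+1 0 false h = h.
Proof. by case/hookbP=> x [r [l [-> _ _ _ _]]]; rewrite add_hook_mkhook !cats0. Qed.

Lemma path_leq_nseq x p z : x <= z -> path leq x (nseq p z).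
Proof. by elim: p x => //= p IHp x ->; apply: IHp. Qed.

Lemma last_leq (x z : nat) s : x <= z -> all (leq^~ z) s -> last x s <= z.
Proof. by elim: s x => //= c s IHs x _ /andP[cz]; apply: IHs. Qed.

Lemma add_hookP k p q h : hookb k h ->
  hookb k.+1 (add_hook k.+1 p q h) /\ tab_min (add_hook k.+1 p q h) = tab_min h.
Proof.
case/hookbP=> x [r [l [-> pr pl x0 /and3P[xk rk lk]]]]; rewrite add_hook_mkhook.
have pr' : path leq x (r ++ nseq p k.+1).
  by rewrite cat_path pr path_leq_nseq // ltnW // ltnS last_leq.
have pl' : path ltn x (l ++ nseq q k.+1).
  by rewrite cat_path pl; case: q => //=; rewrite andbT ltnS last_leq.
split; last by rewrite !tab_min_mkhook.
apply/hookbP; exists x, (r ++ nseq p k.+1), (l ++ nseq q k.+1); split=> //.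
have W s : all (leq^~ k) s -> all (leq^~ k.+1) s by apply: sub_all => a /leqW.
by rewrite (leqW xk) !all_cat (W r) // (W l) //= !all_nseq leqnn !orbT.
Qed.

Lemma tab_max_add_hook k p q h : hookb k h -> (p, q) != (0, false) ->
  k < tab_max (add_hook k.+1 p q h).
Proof.
case/hookbP=> x [r [l [-> _ _ _ _]]]; rewrite add_hook_mkhook => pq.
have := leqnn (tab_max (mkhook x (r ++ nseq p k.+1) (l ++ nseq q k.+1))).
rewrite {1}tab_max_leq bounded_mkhook !all_cat !all_nseq.
by case: p q pq => [|p] [] //= _ /and3P[_ /andP[_ ?] /andP[_ ?]].
Qed.

(** Filtering out the letters above k recovers the first part, and the length then gives the number
    of copies. *)
Lemma cat_nseq_inj k r r' p p' : all (leq^~ k) r -> all (leq^~ k) r' ->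
  r ++ nseq p k.+1 = r' ++ nseq p' k.+1 -> r = r' /\ p = p'.
Proof.
move=> rk rk' e; have F s j : all (leq^~ k) s -> filter (leq^~ k) (s ++ nseq j k.+1) = s.
  move=> sk; rewrite filter_cat (all_filterP sk)
    (@eq_in_filter _ _ pred0) ?filter_pred0 ?cats0 //.
  by move=> x; rewrite mem_nseq => /andP[_ /eqP->]; rewrite ltnn.
have er : r = r' by rewrite -(F r p) // e F.
split=> //; have := congr1 size e; rewrite er !size_cat !size_nseq; lia.
Qed.

Lemma add_hook_inj k p p' (q q' : bool) h h' : hookb k h -> hookb k h' ->
  add_hook k.+1 p q h = add_hook k.+1 p' q' h' -> [/\ h = h', p = p' & q = q'].
Proof.
case/hookbP=> x [r [l [-> _ _ _ /and3P[_ rk lk]]]].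
case/hookbP=> x' [r' [l' [-> _ _ _ /and3P[_ rk' lk']]]].
rewrite !add_hook_mkhook => -[-> /cat_nseq_inj[] // -> ->].
move=> /(congr1 flatten); rewrite !flatten_seq1 => /cat_nseq_inj[] // -> e.
by split=> //; case: q q' e => [] [].
Qed.

Lemma leq_sorted_split k r : sorted leq r -> all (leq^~ k.+1) r ->
  exists r' p, r = r' ++ nseq p k.+1 /\ all (leq^~ k) r'.
Proof.
elim: r => [_ _|c r IHr]; first by exists [::], 0.
move=> /= pr /andP[ck rk]; have [ck'|ck'] := leqP c k.
  have [|r' [p [-> r'k]]] := IHr _ rk; first exact: path_sorted pr.
  by exists (c :: r'), p; rewrite /= ck'.
have ec : c = k.+1 by apply/eqP; rewrite eqn_leq ck.
exists [::], (size r).+1; split=> //=; rewrite {1}ec; congr cons.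
apply/all_pred1P/allP => a ar /=; rewrite eqn_leq (allP rk) //.
by rewrite -ec (allP (path_leq_all pr)).
Qed.

(** The corner survives the deletion, and the letters k + 1 sit at the ends of the arm and of the
    leg, at most once in the latter. *)
Lemma add_hook_surj k h : hookb k.+1 h -> tab_min h <= k ->
  exists h' p q, hookb k h' /\ h = add_hook k.+1 p q h'.
Proof.
case/hookbP=> x [r [l [-> pr pl x0 /and3P[_ rk lk]]]]; rewrite tab_min_mkhook // => xk.
have [r' [p [er r'k]]] := leq_sorted_split (path_sorted pr) rk.
have [l' [q [el l'k]]] := leq_sorted_split (path_sorted (path_ltn_leq pl)) lk.
have q1 : q <= 1.
  have : uniq l by apply: sorted_uniq (path_sorted pl); [exact: ltn_trans|exact: ltnn].
  by rewrite el cat_uniq => /and3P[_ _]; case: q {el} => [|[|q]] //=; rewrite inE eqxx.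
exists (mkhook x r' l'), p, (q == 1); split; last first.
  by rewrite add_hook_mkhook er el; case: q q1 {el} => [|[]].
apply/hookbP; exists x, r', l'; split => //; last by rewrite xk r'k.
  by move: pr; rewrite er cat_path => /andP[].
by move: pl; rewrite el cat_path => /andP[].
Qed.

Definition zbox (z a : nat) : seq (seq nat) := [:: nseq a.+1 z].

Lemma zboxP k a : hookb k.+1 (zbox k.+1 a) /\ tab_min (zbox k.+1 a) = k.+1.
Proof.
have pn : path leq k.+1 (nseq a k.+1) by apply: path_leq_nseq.
have -> : zbox k.+1 a = mkhook k.+1 (nseq a k.+1) [::] by [].
split; last by rewrite tab_min_mkhook.
by apply/hookbP; exists k.+1, (nseq a k.+1), [::]; split;
  rewrite //= leqnn all_nseq /= leqnn orbT.
Qed.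

(** The corner is already the largest letter, which leaves nothing for a strictly increasing leg. *)
Lemma zbox_surj k h : hookb k.+1 h -> k < tab_min h -> exists a, h = zbox k.+1 a.
Proof.
case/hookbP=> x [r [l [-> pr pl x0 /and3P[xk rk lk]]]]; rewrite tab_min_mkhook // => kx.
have ex : x = k.+1 by apply/eqP; rewrite eqn_leq xk.
exists (size r); rewrite /mkhook /zbox.
have -> : l = [::].
  case: l pl lk => //= c l /andP[xc _] /andP[ck _].
  by move: xc; rewrite ex ltnNge ck.
rewrite -ex /=; congr ((_ :: _) :: _); apply/all_pred1P/allP => a ar /=.
by rewrite eqn_leq (allP (path_leq_all pr)) // {1}ex (allP rk).
Qed.

(** * Deletion in one row *)

Definition row_ok k r := all (hookb k) r && sorted tab_le r.

(* ((p, q), s) records the letters z added to a row: p of them to the arm and *)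
(* q to the leg of its last box, then new boxes of arms s filled with z only. *)
Definition row_data := ((nat * bool) * seq nat)%type.

Definition modlast (T : Type) (f : T -> T) (r : seq T) : seq T :=
  if r is x :: r' then rcons (belast x r') (f (last x r')) else [::].

Lemma modlast_rcons (T : Type) (f : T -> T) r x : modlast f (rcons r x) = rcons r (f x).
Proof. by case: r => //= a r; rewrite belast_rcons last_rcons. Qed.

Lemma size_modlast (T : Type) (f : T -> T) r : size (modlast f r) = size r.
Proof. by case/lastP: r => // r x; rewrite modlast_rcons !size_rcons. Qed.

Lemma nth_modlast (T : Type) x0 (f : T -> T) r j : j < size r ->
  nth x0 (modlast f r) j = if j.+1 == size r then f (nth x0 r j) else nth x0 r j.
Proof.
case/lastP: r => // r x; rewrite modlast_rcons size_rcons ltnS eqSS => jr.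
by rewrite !nth_rcons; case: ltngtP jr.
Qed.

Definition ext_row (z : nat) (r : seq (seq (seq nat))) (d : row_data) :=
  modlast (add_hook z d.1.1 d.1.2) r ++ [seq zbox z a | a <- d.2].

(** An empty row has no last box to receive letters; forcing the trivial record there keeps the
    encoding injective. *)
Definition data_fits (r : seq (seq (seq nat))) (d : row_data) : bool :=
  (r == [::]) ==> (d.1 == (0, false)).

Lemma size_ext_row z r d : size (ext_row z r d) = size r + size d.2.
Proof. by rewrite size_cat size_modlast size_map. Qed.

Lemma nth_ext_row z r d j : nth [::] (ext_row z r d) j =
  if j < size r
  then if j.+1 == size r then add_hook z d.1.1 d.1.2 (nth [::] r j) else nth [::] r j
  else nth [::] [seq zbox z a | a <- d.2] (j - size r).
Proof. by rewrite nth_cat size_modlast; case: ifP => // jr; rewrite nth_modlast. Qed.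

Lemma nth_zbox_min k s j : j < size s ->
  tab_min (nth [::] [seq zbox k.+1 a | a <- s] j) = k.+1.
Proof. by move=> js; rewrite (nth_map 0) //; have [] := zboxP k (nth 0 s j). Qed.

Lemma ext_row_all k r d : all (hookb k) r -> all (hookb k.+1) (ext_row k.+1 r d).
Proof.
move=> rk; rewrite all_cat; apply/andP; split; last first.
  by apply/allP => _ /mapP[a _ ->]; have [] := zboxP k a.
case/lastP: r rk => // r x; rewrite modlast_rcons !all_rcons => /andP[xk rk].
by have [-> _] := add_hookP d.1.1 d.1.2 xk; apply: sub_all rk => h; apply: hookbW.
Qed.

Lemma row_ok_ext_row k r d : row_ok k r -> row_ok k.+1 (ext_row k.+1 r d).
Proof.
case/andP=> rk /(sortedP [::]) sr; have Rk := ext_row_all d rk; rewrite /row_ok Rk.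
apply/(sortedP [::]) => j; rewrite size_ext_row => jR.
have := allP Rk _ (mem_nth [::] (_ : j < size (ext_row k.+1 r d))).
rewrite size_ext_row => /(_ (ltnW jR)) /hookb_tab_max hj.
rewrite /tab_le; have [jr|jr] := ltnP j.+1 (size r); last first.
  apply: (leq_trans hj); rewrite nth_ext_row (ltnNge j.+1) jr /= nth_zbox_min //; lia.
rewrite !nth_ext_row jr (ltnW jr) (ltn_eqF jr).
have hj1 := all_nthP [::] rk _ jr.
by case: ifP => _; [have [_ ->] := add_hookP d.1.1 d.1.2 hj1|]; apply: sr.
Qed.

Lemma ext_row_cons2 z h h2 r d : ext_row z (h :: h2 :: r) d = h :: ext_row z (h2 :: r) d.
Proof. by []. Qed.

(** Induction from the right end of the row: only the last box with minimum at most k can mix k + 1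
    with smaller letters. *)
Lemma ext_row_surj k R : row_ok k.+1 R ->
  exists r d, [/\ row_ok k r, data_fits r d & R = ext_row k.+1 r d].
Proof.
elim: R => [_|h R IHR].
  by exists [::], ((0, false), [::]).
case/andP=> /= /andP[hk Rk] pR.
have [|r [[[p q] s] [rk rd eR]]] := IHR; first by rewrite /row_ok Rk (path_sorted pR).
have [hm|hm] := leqP (tab_min h) k; last first.
  have [a ->] := zbox_surj hk hm; exists [::], ((0, false), a :: s); split=> //.
  (* An older box further right would have minimum at most k, against the row condition. *)
  suff r0 : r = [::].
    by rewrite eR r0; move: rd; rewrite r0.
  case: r eR rk {rd} => // h1 r eR /andP[/= /andP[h1k _] _].
  have : tab_le h (nth [::] R 0).
    by case: (R) eR pR => [|? ?] //=; [rewrite /ext_row /modlast; case: (r)|move=> _ /andP[]].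
  rewrite eR nth_ext_row /tab_le /=; set m := tab_min (if _ then _ else _).
  have -> : m = tab_min h1.
    by rewrite /m; case: ifP => // _; have [] := add_hookP p q h1k.
  move=> le1; have := leq_trans (hookb_min_le_max hk) le1.
  by rewrite leqNgt (leq_trans _ hm) // ltnS hookb_tab_min.
(* If no older box follows, [h] is the last one and may hold letters k + 1; otherwise its letters
   are bounded by the minimum of the next box, which is at most k. *)
case: r rk rd eR => [|h1 r] rk rd eR.
  have [h' [p' [q' [h'k ->]]]] := add_hook_surj hk hm.
  by exists [:: h'], ((p', q'), s); split; rewrite // ?/row_ok /= ?h'k // eR.
exists (h :: h1 :: r), ((p, q), s); split=> //; last by rewrite ext_row_cons2 eR.
have h1k : hookb k h1 by case/andP: rk => /= /andP[].
have le1 : tab_le h h1.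
  have : tab_le h (nth [::] R 0).
    by case: (R) eR pR => [|? ?] //=; [rewrite /ext_row /modlast; case: (r)|move=> _ /andP[]].
  rewrite eR nth_ext_row /tab_le /=; case: ifP => // _.
  by have [_ ->] := add_hookP p q h1k.
case/andP: rk => r1 r2; apply/andP; split; last by rewrite /= le1.
by rewrite /= in r1 *; rewrite r1 andbT; apply: hookbS hk (leq_trans le1 (hookb_tab_min h1k)).
Qed.

(** This recovers the length of the old row from the extended one, which [ext_row_inj] uses to cut
    the concatenation. *)
Lemma count_ext_row k r d : all (hookb k) r ->
  count (fun h => tab_min h <= k) (ext_row k.+1 r d) = size r.
Proof.
move=> rk; rewrite count_cat -[RHS]addn0; congr (_ + _); last first.
  apply/eqP; rewrite -leqn0 leqNgt -has_count; apply/hasPn => _ /mapP[a _ ->].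
  by have [_ ->] := zboxP k a; rewrite ltnn.
rewrite -(size_modlast (add_hook k.+1 d.1.1 d.1.2)); apply/eqP; rewrite -all_count.
case/lastP: r rk => // r x; rewrite modlast_rcons !all_rcons => /andP[xk rk].
have [_ ->] := add_hookP d.1.1 d.1.2 xk; rewrite hookb_tab_min //.
by apply: sub_all rk => h; apply: hookb_tab_min.
Qed.

Lemma ext_row_inj k r r' d d' : all (hookb k) r -> all (hookb k) r' ->
  data_fits r d -> data_fits r' d' ->
  ext_row k.+1 r d = ext_row k.+1 r' d' -> r = r' /\ d = d'.
Proof.
move=> rk rk' rd rd' e; have := congr1 (count (fun h => tab_min h <= k)) e.
rewrite !count_ext_row // => sz; move/eqP: e; rewrite eqseq_cat ?size_modlast //.
case/andP=> /eqP em /eqP es; have {}es : d.2 = d'.2.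
  by apply: inj_map es => a b [] /(congr1 size); rewrite !size_nseq.
case: d d' rd rd' em es => [[p q] s] [[p' q'] s'] /= rd rd' em <-.
case/lastP: r rk rd sz em => [|r x] rk rd.
  by move/esym/size0nil=> e; move: rd rd'; rewrite e /data_fits /= => /eqP[-> ->] /eqP[-> ->].
case/lastP: r' rk' {rd'} => [|r' x' rk']; first by rewrite size_rcons.
rewrite !modlast_rcons => _ /rcons_inj e.
have [-> ex] : r = r' /\ add_hook k.+1 p q x = add_hook k.+1 p' q' x'.
  by split; [exact: (congr1 fst e)|exact: (congr1 snd e)].
move: rk rk'; rewrite !all_rcons => /andP[xk _] /andP[xk' _].
by have [-> -> ->] := add_hook_inj xk xk' ex.
Qed.

(** * Deletion and the column condition *)

Lemma aboveP (T : Type) (lt : rel T) x0 r1 r2 : reflect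
  (size r2 <= size r1 /\ forall j, j < size r2 -> lt (nth x0 r1 j) (nth x0 r2 j))
  (above lt r1 r2).
Proof.
rewrite /above; elim: r2 r1 => [|y r2 IHr] [|x r1] /=; try by constructor.
  by constructor => -[].
apply: (iffP andP) => [[xy /IHr[le h]]|[le h]]; first by split=> // -[|j] //; apply: h.
split; first exact: (h 0).
by apply/IHr; split=> // j; apply: (h j.+1).
Qed.

(** All minima in the lower row are at most k + 1, so no box above one of them may contain k + 1.
    Hence the whole lower row lies under old boxes, and strictly short of the last one if that box
    received letters. Letters added to the lower row do not change its old minima. *)
Lemma above_ext_row k r1 r2 d1 d2 : all (hookb k) r1 -> all (hookb k) r2 -> data_fits r1 d1 ->
  above tab_lt (ext_row k.+1 r1 d1) (ext_row k.+1 r2 d2) <->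
  [/\ above tab_lt r1 r2, size r2 + size d2.2 <= size r1
    & (d1.1 != (0, false)) -> size r2 + size d2.2 < size r1].
Proof.
move=> rk1 rk2 rd1; have Rk2 := ext_row_all d2 rk2.
have min2 j : j < size r2 + size d2.2 -> tab_min (nth [::] (ext_row k.+1 r2 d2) j) <= k.+1.
  by move=> jR; apply: hookb_tab_min; apply: (all_nthP [::] Rk2); rewrite size_ext_row.
have min2' j : j < size r2 ->
    tab_min (nth [::] (ext_row k.+1 r2 d2) j) = tab_min (nth [::] r2 j).
  move=> j2; have h2 := all_nthP [::] rk2 _ j2; rewrite nth_ext_row j2; case: ifP => // _.
  by have [] := add_hookP d2.1.1 d2.1.2 h2.
split.
  case/(aboveP _ [::]); rewrite !size_ext_row => sz h.
  have le : size r2 + size d2.2 <= size r1.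
    rewrite leqNgt; apply/negP => lt1; have := h _ lt1; rewrite /tab_lt ltnNge.
    rewrite (leq_trans (min2 _ lt1)) // nth_ext_row ltnn subnn.
    have s1 : 0 < size d1.2 by lia.
    rewrite -{1}(nth_zbox_min k s1) (nth_map 0) //.
    by have [/hookb_min_le_max] := zboxP k (nth 0 d1.2 0).
  have lt : d1.1 != (0, false) -> size r2 + size d2.2 < size r1.
    rewrite ltn_neqAle le andbT => d1n0; apply/negP => /eqP e.
    have r10 : 0 < size r1.
      by case: (r1) rd1 => //; rewrite /data_fits eqxx /= (negPf d1n0).
    have lt1 : (size r1).-1 < size r1 by rewrite prednK.
    have := h (size r1).-1; rewrite e => /(_ lt1); rewrite /tab_lt ltnNge.
    rewrite (leq_trans (min2 _ _)) ?e // nth_ext_row lt1 prednK // eqxx.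
    apply: tab_max_add_hook; first exact: (all_nthP [::] rk1).
    by case: (d1.1) d1n0.
  split=> //; apply/(aboveP _ [::]); split=> [|j j2]; first by lia.
  have jR : j < size r2 + size d2.2 by lia.
  have j1 : j < size r1 by lia.
  have := h j jR; rewrite /tab_lt min2' // nth_ext_row j1; case: ifP => // /eqP ej.
  have [e|/lt] := eqVneq d1.1 (0, false); last by lia.
  by rewrite e add_hook00 //; apply: (all_nthP [::] rk1).
case=> /(aboveP _ [::])[sz h] le lt; apply/(aboveP _ [::]); rewrite !size_ext_row.
split=> [|j jR]; first by lia.
have j1 : j < size r1 by lia.
have -> : nth [::] (ext_row k.+1 r1 d1) j = nth [::] r1 j.
  rewrite nth_ext_row j1; case: ifP => // /eqP ej.
  have [e|/lt] := eqVneq d1.1 (0, false); last by lia.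
  by rewrite e add_hook00 //; apply: (all_nthP [::] rk1).
rewrite /tab_lt; have [j2|j2] := ltnP j (size r2); first by rewrite min2' //; apply: h.
rewrite nth_ext_row (ltnNge j) j2 /= nth_zbox_min ?ltnS; last by lia.
by apply: hookb_tab_max; apply: (all_nthP [::] rk1).
Qed.

(** * Deletion in a whole tableau *)

Definition tab_ok k (T : hvtab) := all (row_ok k) T && sorted (above tab_lt) T.

Lemma all_flatten (T : Type) (a : pred T) ss : all a (flatten ss) = all (all a) ss.
Proof. by elim: ss => //= s ss IHss; rewrite all_cat IHss. Qed.

Lemma HT_tab_ok k la T :
  (HT la T /\ all (leq^~ k) (hv_entries T)) <-> (shape T = la /\ tab_ok k T).
Proof.
have -> : tab_ok k T = [&& all hook_tableau (flatten T), all (leq^~ k) (hv_entries T)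
    & semistandard tab_le tab_lt T].
  rewrite /tab_ok /semistandard !andbA; congr andb.
  rewrite /hv_entries !all_flatten -!all_predI; apply: eq_all => r /=.
  rewrite /row_ok -all_predI; congr andb; apply: eq_all => h /=.
  by rewrite /hookb /bounded all_flatten.
rewrite /HT /=; split=> [[/and3P[/eqP-> -> ->] ->]|[-> /and3P[-> -> ->]]] //.
by rewrite eqxx.
Qed.

Definition ext_tab (z : nat) (T : hvtab) (D : seq row_data) : hvtab :=
  [seq ext_row z x.1 x.2 | x <- zip T D].

(** The combinatorial counterpart of [row_weight]: the first test matches the power of z, the second
    the factor 1 + t z. *)
Definition row_data_ok (hi lo m : nat) (d : row_data) : bool :=
  (size d.2 == hi - m) && ((lo < m) || (d.1 == (0, false))).

Fixpoint data_ok (la mu : seq nat) (D : seq row_data) : bool :=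
  match la, mu, D with
  | a :: l, m :: mu', d :: D' => row_data_ok a (head 0 l) m d && data_ok l mu' D'
  | [::], [::], [::] => true
  | _, _, _ => false
  end.

Definition data0 : row_data := ((0, false), [::]).

Lemma data_okP la mu D : size mu = size la -> reflect
  (size D = size la /\ forall i, i < size la ->
      row_data_ok (nth 0 la i) (nth 0 la i.+1) (nth 0 mu i) (nth data0 D i))
  (data_ok la mu D).
Proof.
elim: la mu D => [|a l IHl] [|m mu] [|d D] //= sz; try by constructor; case.
  by constructor.
case: sz => sz; apply: (iffP andP) => [[d1 /(IHl _ _ sz)[sD h]]|[[sD] h]].
  by split=> [|[_|i /h //]]; [rewrite sD|rewrite -nth0 in d1].
split; first by rewrite -nth0; apply: (h 0).
by apply/(IHl _ _ sz); split=> // i il; apply: (h i.+1).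
Qed.

Lemma size_ext_tab z T D : size D = size T -> size (ext_tab z T D) = size T.
Proof. by move=> sz; rewrite size_map size_zip sz minnn. Qed.

Lemma nth_ext_tab z T D i : size D = size T -> i < size T ->
  nth [::] (ext_tab z T D) i = ext_row z (nth [::] T i) (nth data0 D i).
Proof.
by move=> sz iT; rewrite (nth_map ([::], data0)) ?nth_zip ?size_zip ?sz ?minnn.
Qed.

(** For an empty row m = 0, so the test lo < m fails and the record of the last box is trivial. *)
Lemma data_ok_fits la T D i : data_ok la (shape T) D -> size T = size la -> i < size T ->
  data_fits (nth [::] T i) (nth data0 D i).
Proof.
move=> /data_okP; rewrite size_map => H sz iT; have {H}[//|sD h] := H.
rewrite sz in iT; have /andP[_] := h i iT; rewrite nth_shape.
by rewrite /data_fits; case: (nth [::] T i).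
Qed.

Lemma ext_tab_ok k la T D :
  tab_ok k T -> shape T \in interlacing 0 la -> data_ok la (shape T) D ->
  shape (ext_tab k.+1 T D) = la /\ tab_ok k.+1 (ext_tab k.+1 T D).
Proof.
case/andP=> rT sT /mem_interlacingP[]; rewrite size_map => sz hi oD.
have dT i := data_ok_fits oD sz (i := i).
have szs : size (shape T) = size la by rewrite size_map.
have [sD hD] := elimT (data_okP _ szs) oD.
have sDT : size D = size T by rewrite sD.
have rk i : i < size T -> row_ok k (nth [::] T i) by apply: (all_nthP [::] rT).
have hk i : i < size T -> all (hookb k) (nth [::] T i) by move=> /rk/andP[].
have szr i : i < size T -> size (nth [::] T i) + size (nth data0 D i).2 = nth 0 la i.
  move=> iT; have := iT; rewrite sz => il.
  have /andP[/eqP-> _] := hD i il; rewrite nth_shape subnKC //.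
  by have /andP[_] := hi i il; rewrite nth_shape.
split.
  apply: (@eq_from_nth _ 0) => [|i]; rewrite size_map size_ext_tab // => iT.
  by rewrite nth_shape nth_ext_tab // size_ext_row szr.
apply/andP; split.
  by apply/(all_nthP [::]) => i; rewrite size_ext_tab // => iT;
  rewrite nth_ext_tab // row_ok_ext_row // rk.
apply/(sortedP [::]) => i; rewrite size_ext_tab // => iT.
have iT' := ltnW iT; rewrite !nth_ext_tab //; apply/above_ext_row; rewrite ?hk ?dT //.
have il : i < size la by rewrite -sz.
rewrite szr //; split; first by move/(sortedP [::]): sT; apply.
  by have /andP[+ _] := hi i il; rewrite nth_shape.
by move=> /negPf d1; have /andP[_] := hD i il; rewrite d1 orbF nth_shape.
Qed.

Lemma ext_tab_rows_surj k T : all (row_ok k.+1) T -> exists T' D,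
  [/\ T = ext_tab k.+1 T' D, size D = size T', all (row_ok k) T'
    & forall i, i < size T' -> data_fits (nth [::] T' i) (nth data0 D i)].
Proof.
elim: T => [_|R T IHT /= /andP[/ext_row_surj[r [d [rk rd ->]]] /IHT[T' [D [-> sD T'k dT]]]]].
  by exists [::], [::].
by exists (r :: T'), (d :: D); split=> //=; rewrite ?sD ?rk // => -[].
Qed.

Lemma ext_tab_surj k la T : shape T = la -> tab_ok k.+1 T -> exists T' D,
  [/\ T = ext_tab k.+1 T' D, tab_ok k T', shape T' \in interlacing 0 la
    & data_ok la (shape T') D].
Proof.
move=> shT /andP[/ext_tab_rows_surj[T' [D [eT sD T'k dT]]] sT].
have sz : size T' = size la by rewrite -shT eT size_map size_ext_tab.
have rk i : i < size T' -> row_ok k (nth [::] T' i) by apply: (all_nthP [::] T'k).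
have hk i : i < size T' -> all (hookb k) (nth [::] T' i) by move=> /rk/andP[].
have szr i : i < size T' -> size (nth [::] T' i) + size (nth data0 D i).2 = nth 0 la i.
  by move=> iT; rewrite -(size_ext_row k.+1) -nth_ext_tab // -eT -shT nth_shape.
have ab i : i.+1 < size T' -> [/\ above tab_lt (nth [::] T' i) (nth [::] T' i.+1),
    nth 0 la i.+1 <= size (nth [::] T' i)
  & ((nth data0 D i).1 != (0, false)) -> nth 0 la i.+1 < size (nth [::] T' i)].
  move=> iT; have iT' := ltnW iT; rewrite -szr //.
  apply/(above_ext_row _ (hk _ iT') (hk _ iT) (dT _ iT')).
  rewrite -!nth_ext_tab // -eT; move/(sortedP [::]): sT; apply.
  by rewrite eT size_ext_tab.
exists T', D; split=> //.
- by rewrite /tab_ok T'k; apply/(sortedP [::]) => i /ab[].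
- apply/mem_interlacingP; rewrite size_map; split=> // i; rewrite -sz nth_shape => iT.
  rewrite -[nth 0 la i]szr // leq_addr andbT.
  have [/ab[] //|iT'] := ltnP i.+1 (size T'); by rewrite nth_default // -sz.
- apply/data_okP; rewrite ?size_map // -sz; split=> // i iT; rewrite nth_shape.
  apply/andP; split; first by rewrite -szr // addKn.
  case: eqP => [|/eqP d1]; first by rewrite orbT.
  rewrite orbF; have [/ab[_ _]|iT'] := ltnP i.+1 (size T'); first exact.
  (* Nothing lies below the last row, so the bound is the default 0, and [data_fits] says that the
     row is not empty. *)
  rewrite [nth _ la _]nth_default -?sz //.
  by have := dT i iT; rewrite /data_fits (negPf d1) implybF -size_eq0 lt0n.
Qed.

Lemma ext_tab_inj k la T T' D D' :
  size T = size la -> size T' = size la ->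
  tab_ok k T -> tab_ok k T' -> data_ok la (shape T) D -> data_ok la (shape T') D' ->
  ext_tab k.+1 T D = ext_tab k.+1 T' D' -> T = T' /\ D = D'.
Proof.
move=> sT sT' /andP[Tk _] /andP[Tk' _] oD oD' e.
have szs : size (shape T) = size la by rewrite size_map.
have [sD _] := elimT (data_okP _ szs) oD.
have szs' : size (shape T') = size la by rewrite size_map.
have [sD' _] := elimT (data_okP _ szs') oD'.
have H i : i < size la -> nth [::] T i = nth [::] T' i /\ nth data0 D i = nth data0 D' i.
  move=> il; have := congr1 (fun t => nth [::] t i) e.
  rewrite !nth_ext_tab ?sT ?sT' ?sD ?sD' //; apply: ext_row_inj.
  - by have /andP[] : row_ok k (nth [::] T i) by apply: (all_nthP [::] Tk); rewrite sT.
  - by have /andP[] : row_ok k (nth [::] T' i) by apply: (all_nthP [::] Tk'); rewrite sT'.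
  - by apply: data_ok_fits oD _ _; rewrite ?sT.
  - by apply: data_ok_fits oD' _ _; rewrite ?sT'.
split.
  by apply: (@eq_from_nth _ [::]) => [|i]; rewrite sT // => /H[].
by apply: (@eq_from_nth _ data0) => [|i]; rewrite sD // => /H[].
Qed.

(** Letters are positive, so no hook is bounded by 0 and every row is empty. *)
Lemma tab_ok0 la T : (shape T = la /\ tab_ok 0 T) <->
  (all (pred1 0) la /\ T = nseq (size la) [::]).
Proof.
have H0 h : hookb 0 h = false.
  by apply/hookbP => -[x [r [l [_ _ _ + /andP[]]]]]; case: x.
split=> [[<- /andP[rT _]]|[/all_pred1P-> ->]].
  have -> : T = nseq (size T) [::].
    apply/all_pred1P; apply: sub_all rT => r /andP[].
    by case: r => //= h r; rewrite H0.
  by rewrite size_map size_nseq /shape map_nseq all_nseq /= orbT.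
rewrite !size_nseq /shape map_nseq; split=> //; apply/andP; split.
  by rewrite all_nseq orbT.
by elim: (size la) => // -[|n].
Qed.

(** * Weights under deletion *)

Section Weights.
Local Open Scope ring_scope.
Context (A : comNzRingType) (al be : A) (xv : nat -> A).

Definition hook_term h : A := al ^+ arm h * be ^+ leg h * \prod_(c <- flatten h) xv c.
Definition tab_term (T : hvtab) : A := \prod_(r <- T) \prod_(h <- r) hook_term h.
Definition data_term (z : nat) (d : row_data) : A :=
  (al * xv z) ^+ d.1.1 * (be * xv z) ^+ d.1.2 * \prod_(a <- d.2) (xv z * (al * xv z) ^+ a).

Lemma prod_nseq p z : \prod_(c <- nseq p z) xv c = xv z ^+ p.
Proof. by elim: p => [|p IHp]; rewrite ?big_nil // big_cons IHp exprS. Qed.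

Lemma hook_term_zbox z a : hook_term (zbox z a) = xv z * (al * xv z) ^+ a.
Proof.
rewrite /hook_term /= cats0 big_cons prod_nseq expr0 /arm /= size_nseq exprMn /=.
ring.
Qed.

Lemma hook_term_add_hook k z p q h : hookb k h ->
  hook_term (add_hook z p q h) = hook_term h * ((al * xv z) ^+ p * (be * xv z) ^+ q).
Proof.
case/hookbP=> x [r [l [-> _ _ _ _]]]; rewrite add_hook_mkhook /hook_term.
rewrite !arm_mkhook !leg_mkhook !flatten_mkhook !size_cat !size_nseq.
rewrite !big_cons !big_cat /= !prod_nseq !exprD !exprMn; ring.
Qed.

Lemma row_term_ext_row k z r d : all (hookb k) r -> data_fits r d ->
  \prod_(h <- ext_row z r d) hook_term h = \prod_(h <- r) hook_term h * data_term z d.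
Proof.
move=> rk rd; rewrite big_cat /= big_map /data_term mulrA.
congr (_ * _); last by apply: eq_bigr => a _; rewrite hook_term_zbox.
case/lastP: r rk rd => [_ /eqP->|r x]; first by rewrite big_nil mul1r !expr0 mulr1.
rewrite modlast_rcons all_rcons => /andP[xk _] _.
by rewrite -!cats1 !big_cat !big_seq1 /= (hook_term_add_hook _ _ _ xk) mulrA.
Qed.

Lemma tab_term_ext k z la T D : tab_ok k T -> size T = size la -> data_ok la (shape T) D ->
  tab_term (ext_tab z T D) = tab_term T * \prod_(d <- D) data_term z d.
Proof.
move=> /andP[Tk _] sz oD; have dT i := data_ok_fits oD sz (i := i).
have szs : size (shape T) = size la by rewrite size_map.
have [sD _] := elimT (data_okP _ szs) oD.
rewrite -sz in sD; move: {oD sz szs la} Tk dT sD; rewrite /tab_term /ext_tab.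
elim: T D => [|r T IHT] [|d D] //=; first by rewrite !big_nil mulr1.
move=> /andP[/andP[rk _] Tk] dT [sD]; rewrite !big_cons /=.
rewrite (row_term_ext_row _ rk (dT 0 isT)) IHT // => [|i iT]; last exact: (dT i.+1).
by rewrite mulrACA.
Qed.

End Weights.

End HookValued.

(** * Generating functions *)

Section Hsum.
Context (n : nat) (R : comNzRingType) (al be : R).
Notation fpsR := (fps n R).

(** Letters start at 1 and variable indices at 0; letters outside 1, ..., n are sent to 0, so
    tableaux containing them have weight 0. *)
Definition fps_var (c : nat) : fpsR :=
  if c is c'.+1 then oapp (@fpsX n R) 0 (insub c') else 0.

Lemma fps_var_ord (i : 'I_n) : fps_var i.+1 = fpsX i.
Proof. by rewrite /fps_var valK. Qed.

Lemma fps_var0 c : fps_var c 0%MM = 0.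
Proof.
case: c => [|c] //=; case: insub => //= i; rewrite /fpsX.
by case: eqP => // /(congr1 mdeg); rewrite mdeg0 mdeg1.
Qed.

Lemma fpsM0 (f g : fpsR) : g 0%MM = 0 -> (f * g) 0%MM = 0.
Proof.
move=> g0; rewrite (@eq_below_mul _ _ 1 f f g 0) ?mulr0 ?mdeg0 // => m.
by rewrite ltnS leqn0 mdeg_eq0 => /eqP->.
Qed.

Notation A := (fpsC al : fpsR).
Notation B := (fpsC be : fpsR).
Definition fps_yvar (c : nat) : fpsR := fps_var c / (1 - A * fps_var c).

Lemma unit_1B_fps_var c : 1 - A * fps_var c \is a GRing.unit.
Proof. by apply: fps_unit_1B; apply: fpsM0; apply: fps_var0. Qed.

Lemma unit_1D_fps_var c : 1 + B * fps_var c \is a GRing.unit.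
Proof.
rewrite -[B * _]opprK; apply: fps_unit_1B.
by rewrite fpsNE fpsM0 ?oppr0 //; apply: fps_var0.
Qed.

(** As a quotient of two series with constant term 1, this is even a unit. *)
Lemma fps_yvar_reg c : GRing.lreg (1 + (A + B) * fps_yvar c).
Proof.
apply: mulrI; rewrite one_addM_div ?unit_1B_fps_var //.
by rewrite unitrM unitrV unit_1B_fps_var unit_1D_fps_var.
Qed.

Lemma has_sum_mull (I : eqType) (P : I -> Prop) F (c S : fpsR) :
  has_sum P F S -> has_sum P (fun t => c * F t) (c * S).
Proof.
move=> hP d; have [s [us sP Ps eS]] := hP d; exists s; split=> //.
  by move=> t Pt ts; rewrite -(mulr0 c); apply: eq_below_mul => //; apply: Ps.
by rewrite -mulr_sumr; apply: eq_below_mul.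
Qed.

(** Summing over the arm of one box gives x / (1 - alpha x) = y, and the c boxes are independent. *)
Lemma has_sum_zboxes z c : has_sum (fun s : seq nat => size s = c)
  (fun s => \prod_(a <- s) (fps_var z * (A * fps_var z) ^+ a)) (fps_yvar z ^+ c).
Proof.
elim: c => [|c IHc].
  apply: (@has_sum_ext _ _ _ (fun s => s \in [:: [::]]) _ (fun=> 1)).
  - by move=> s; rewrite inE; split=> [/eqP->|/size0nil->].
  - by move=> s; rewrite inE => /eqP->; rewrite big_nil.
  - by have := @has_sum_seq n R _ [:: [::] : seq nat] (fun=> 1) isT; rewrite big_seq1.
have hg := has_sum_mull (fps_var z) (has_sum_geom (fpsM0 A (fps_var0 z))).
rewrite exprS; apply: (@has_sum_bij _ _ _ _ _ _ _ _ _ (fun x => x.1 :: x.2) _ _ _ _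
  (has_sum_prod hg IHc)) => [||[|a s] //|].
- by move=> [a s] /= [_ ->].
- by move=> [a s] [b s'] /= _ _ [-> ->].
- by move=> [sc]; exists (a, s).
- by move=> [a s] /= _; rewrite big_cons.
Qed.

(** Arm letters give 1 / (1 - alpha x) and the optional leg letter gives 1 + beta x; the product is
    1 + t y. *)
Lemma has_sum_corner z (b : bool) :
  has_sum (fun pq : nat * bool => b || (pq == (0%N, false)))
    (fun pq => (A * fps_var z) ^+ pq.1 * (B * fps_var z) ^+ pq.2)
    ((1 + (A + B) * fps_yvar z) ^+ b).
Proof.
case: b.
  rewrite expr1 one_addM_div ?unit_1B_fps_var // [X in has_sum _ _ X]mulrC.
  have hb := @has_sum_seq n R _ [:: false; true] (fun q => (B * fps_var z) ^+ q) isT.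
  rewrite big_cons big_seq1 expr0 expr1 in hb.
  apply: has_sum_ext (has_sum_prod (has_sum_geom (fpsM0 A (fps_var0 z))) hb) => //= -[p q] /=.
  by rewrite !inE; case: q.
have := @has_sum_seq n R _ [:: (0%N, false)] (fun pq : nat * bool =>
  (A * fps_var z) ^+ pq.1 * (B * fps_var z) ^+ pq.2) isT.
rewrite big_seq1 /= !expr0 mulr1; apply: has_sum_ext => // pq.
by rewrite inE.
Qed.

Lemma has_sum_row_data z hi lo m : has_sum (fun d => row_data_ok hi lo m d)
  (data_term A B fps_var z) (row_weight (A + B) (fps_yvar z) hi lo m).
Proof.
rewrite /row_weight [X in has_sum _ _ X]mulrC.
apply: has_sum_ext
  (has_sum_prod (has_sum_corner z (lo < m)%N) (has_sum_zboxes z (hi - m))) => //.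
move=> [pq s]; rewrite /row_data_ok /=.
by split=> [[-> ->]|/andP[/eqP-> ->]]; rewrite ?eqxx.
Qed.

Lemma has_sum_data z la mu : size mu = size la ->
  has_sum (fun D => data_ok la mu D) (fun D => \prod_(d <- D) data_term A B fps_var z d)
    (skew_weight (A + B) (fps_yvar z) 0 la mu).
Proof.
elim: la mu => [|a l IHl] [|m mu] //=; [move=> _|move=> [sz]].
  apply: (@has_sum_ext _ _ _ (fun s => s \in [:: [::]]) _ (fun=> 1)).
  - by case=> [|? ?].
  - by move=> s; rewrite inE => /eqP->; rewrite big_nil.
  - by have := @has_sum_seq n R _ [:: [::] : seq row_data] (fun=> 1) isT; rewrite big_seq1.
apply: (@has_sum_bij _ _ _ _ _ _ _ _ _ (fun x => x.1 :: x.2) _ _ _ _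
  (has_sum_prod (has_sum_row_data z a (head 0%N l) m) (IHl _ sz))) => [||[|d D] //|].
- by move=> [d D] /= [-> ->].
- by move=> [d D] [d' D'] /= _ _ [-> ->].
- by move=> /andP[h1 h2]; exists (d, D).
- by move=> [d D] /= _; rewrite big_cons.
Qed.

Lemma has_sum_tab_ok k la : has_sum (fun T : hvtab => shape T = la /\ tab_ok k T)
  (tab_term A B fps_var) (branch (A + B) fps_yvar k la).
Proof.
elim: k la => [|k IHk] la.
  pose s : seq hvtab := if all (pred1 0%N) la then [:: nseq (size la) [::]] else [::].
  have us : uniq s by rewrite /s; case: ifP.
  have := @has_sum_seq n R _ s (tab_term A B fps_var) us.
  have -> : \sum_(T <- s) tab_term A B fps_var T = branch (A + B) fps_yvar 0 la.
    rewrite /s /=; case: ifP => _; rewrite ?big_nil // big_seq1 /tab_term big1_seq // => r.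
    by rewrite mem_nseq => /andP[_ /andP[_ /eqP->]]; rewrite big_nil.
  apply: has_sum_ext => // T; rewrite /s; split.
    by case: ifP => // h; rewrite inE => /eqP->; apply/tab_ok0.
  by move/tab_ok0 => [-> ->]; rewrite inE.
pose Q (TD : hvtab * seq row_data) :=
  [/\ tab_ok k TD.1, shape TD.1 \in interlacing 0 la & data_ok la (shape TD.1) TD.2].
have szQ TD : Q TD -> size TD.1 = size la.
  by case=> _ /size_interlacing; rewrite size_map.
have hQ : has_sum Q
    (fun TD => tab_term A B fps_var TD.1 * \prod_(d <- TD.2) data_term A B fps_var k.+1 d)
    (branch (A + B) fps_yvar k.+1 la).
  (* The pairs are grouped by the shape mu of the smaller tableau; within one group tableau and
     record vary independently. *)
  apply: (@has_sum_partition _ _ _ _ _ _ (fun TD => shape TD.1) (interlacing 0 la)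
    (fun mu => branch (A + B) fps_yvar k mu * skew_weight (A + B) (fps_yvar k.+1) 0 la mu)).
  - exact: interlacing_uniq.
  - by move=> TD [].
  - move=> mu mul; have szm := size_interlacing mul.
    apply: has_sum_ext (has_sum_prod (IHk mu) (has_sum_data k.+1 szm)) => // -[T D] /=.
    split=> [[[shT Tk] oD]|[[Tk _ oD] shT]].
      by rewrite /Q /= shT.
    by rewrite /= shT in oD *.
apply: (@has_sum_bij _ _ _ _ _ _ _ _ _ (fun TD => ext_tab k.+1 TD.1 TD.2) _ _ _ _ hQ).
- by move=> [T D] [/= Tk shT oD]; apply: ext_tab_ok.
- move=> [T D] [T' D'] h h' /= e; have [s s'] := (szQ _ h, szQ _ h').
  case: h h' => /= Tk _ oD [/= Tk' _ oD'].
  by have [/= -> ->] := ext_tab_inj s s' Tk Tk' oD oD' e.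
- by move=> T [shT Tk]; have [T' [D [-> ? ? ?]]] := ext_tab_surj shT Tk; exists (T', D).
- by move=> [T D] h; have s := szQ _ h; case: h => /= Tk _ oD; apply: tab_term_ext Tk s oD.
Qed.

Lemma branch_groth_mx la : sorted geq la -> (size la <= n)%N ->
  branch (A + B) fps_yvar n la * \prod_(i < n) \prod_(j < n | (i < j)%N) (fpsX i - fpsX j) =
  \det (groth_mx al be la n).
Proof.
(* Zeros are appended because [branch_det] requires exactly n parts. *)
move=> sla sz; pose la' := la ++ nseq (n - size la) 0%N.
have nla' j : nth 0%N la' j = nth 0%N la j.
  rewrite nth_cat; case: ltnP => // lj; rewrite nth_nseq if_same nth_default //.
have sz' : size la' = n by rewrite size_cat size_nseq subnKC.
have sla' : sorted geq la'.
  apply/(sortedP 0%N) => i _; rewrite !nla'.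
  have [il|il] := ltnP i.+1 (size la); last by rewrite (nth_default _ il).
  by move/(sortedP 0%N): sla; apply.
rewrite -(branch_pad _ _ _ _ (n - size la)) -/la'.
have -> : \prod_(i < n) \prod_(j < n | (i < j)%N) (fpsX i - fpsX j) =
    vandermonde n (fun i => fps_var i.+1) :> fpsR.
  by apply: eq_bigr => i _; apply: eq_bigr => j _; rewrite !fps_var_ord.
rewrite -(@vandermonde_scale _ _ (fun i => fps_yvar i.+1)
  (fun i => 1 - A * fps_var i.+1)); last first.
  move=> i j; rewrite mulrBl {1}/fps_yvar mulrA divrK ?unit_1B_fps_var //.
  rewrite {1}/fps_yvar [(1 - _) * (1 - _)]mulrC mulrA divrK ?unit_1B_fps_var //; ring.
rewrite mulrA branch_det //; last exact: fps_yvar_reg.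
rewrite mulrC -det_scale_row; congr (\det _); apply/matrixP => i j; rewrite !mxE.
have := det_entry_div B (unit_1B_fps_var i.+1) la' (ltn_ord j).
by rewrite nla' fps_var_ord => ->; rewrite /fps_yvar fps_var_ord.
Qed.

End Hsum.

(** * Regularity of the denominator and coefficients of monomials *)

Section Regular.
Context (n : nat) (R : comNzRingType).
Implicit Types (f g : fps n R) (m : 'X_{1..n}).

Definition fps_monom (k : 'X_{1..n}) : fps n R := fun m => (m == k)%:R.

Lemma fpsM_mcoeff f g (p q : {mpoly R[n]}) m :
    (forall k, (mdeg k <= mdeg m)%N -> p@_k = f k) ->
    (forall k, (mdeg k <= mdeg m)%N -> q@_k = g k) ->
  (f * g) m = (p * q)@_m.
Proof. exact: fps_mul_mcoeff. Qed.

Lemma fps_monomD a b : fps_monom (a + b)%MM = fps_monom a * fps_monom b.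
Proof.
apply/funext => m; rewrite (@fpsM_mcoeff _ _ 'X_[a] 'X_[b]).
- by rewrite -mpolyXD mcoeffX eq_sym.
- by move=> k _; rewrite mcoeffX eq_sym.
- by move=> k _; rewrite mcoeffX eq_sym.
Qed.

Lemma fpsMX f i m : (f * fpsX i) (m + U_(i))%MM = f m.
Proof.
pose d := (mdeg (m + U_(i))%MM).+1.
rewrite (@fpsM_mcoeff f (fpsX i) (fps_trunc d f) 'X_i).
- rewrite addmC mcoeffMX mcoeff_trunc // /d mdegD; lia.
- by move=> k km; rewrite mcoeff_trunc.
- by move=> k _; rewrite mcoeffX eq_sym.
Qed.

Lemma fpsMX0 f i m : m i = 0%N -> (f * fpsX i) m = 0.
Proof.
move=> mi; rewrite fpsME big1 // => k /eqP mk; rewrite /fpsX.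
case: eqP => [k2|]; last by rewrite mulr0.
have : m i = ((k.1 + k.2)%MM : 'X_{1..n}) i by rewrite -mk.
by rewrite mi k2 mnmDE mnm1E eqxx addn1.
Qed.

Lemma fpsCM (c : R) f m : (fpsC c * f) m = c * f m.
Proof.
rewrite (@fpsM_mcoeff _ f c%:MP (fps_trunc (mdeg m).+1 f)).
- by rewrite mcoeffCM mcoeff_trunc.
- by move=> k _; rewrite mcoeffC /fpsC; case: eqP; rewrite ?mulr1 ?mulr0.
- by move=> k km; rewrite mcoeff_trunc.
Qed.

Lemma fpsC_mul (c d : R) : fpsC (c * d) = fpsC c * fpsC d :> fps n R.
Proof.
by apply/funext => m; rewrite fpsCM /fpsC; case: eqP; rewrite ?mulr0.
Qed.

Lemma fpsC_exp (c : R) k : fpsC (c ^+ k) = fpsC c ^+ k :> fps n R.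
Proof. by elim: k => [|k IHk] //; rewrite !exprS fpsC_mul IHk. Qed.

(** If f x_i = f x_j, the coefficient of f at m equals the one at m x_i / x_j when x_j divides m,
    and is 0 otherwise. Lowering the exponent of x_j repeatedly shows f = 0 over any coefficient
    ring. *)
Lemma fpsXB_reg (i j : 'I_n) : i != j -> GRing.lreg (fpsX i - fpsX j : fps n R).
Proof.
move=> ij; apply: mulrI0_lreg => f; rewrite mulrC mulrBr => /eqP; rewrite subr_eq0 => /eqP e.
apply/funext => m; have [k] := ubnP (m j); elim: k m => // k IHk m mk.
rewrite -(fpsMX f i) e; have [mj|mj] := eqVneq (m j) 0%N.
  by rewrite fpsMX0 // mnmDE mnm1E (negPf ij) mj.
pose m' := (m + U_(i) - U_(j))%MM.
have -> : (m + U_(i) = m' + U_(j))%MM.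
  apply/mnmP => l; rewrite /m' !(mnmDE, mnmBE, mnm1E).
  by have [<-|] := eqVneq j l; lia.
rewrite fpsMX IHk // /m' mnmBE mnmDE !mnm1E (negPf ij) eqxx; lia.
Qed.

Lemma fps_exdiv_unique f g h : GRing.lreg g -> f * g = h -> fps_exdiv h g = f.
Proof.
move=> rg e; apply: xget_unique => //= q qe; apply: rg.
by rewrite mulrC qe mulrC e.
Qed.

Lemma prod_fpsXB_reg :
  GRing.lreg (\prod_(i < n) \prod_(j < n | (i < j)%N) (fpsX i - fpsX j) : fps n R).
Proof.
apply: (big_ind (fun x : fps n R => GRing.lreg x)) => [||i _]; [exact: lreg1|exact: lregM|].
apply: (big_ind (fun x : fps n R => GRing.lreg x)) => [||j ij]; [exact: lreg1|exact: lregM|].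
by apply: fpsXB_reg; rewrite -val_eqE /= neq_ltn ij.
Qed.

Lemma prod_fps_var s : all (fun c => 0 < c <= n)%N s ->
  \prod_(c <- s) @fps_var n R c = fps_monom [multinom count_mem i.+1 s | i < n].
Proof.
elim: s => [_|c s IHs /= /andP[/andP[c0 cn] sn]].
  rewrite big_nil; apply/funext => m; rewrite fps1E /fps_monom.
  have -> // : 0%MM = [multinom count_mem i.+1 [::] | i < n] :> 'X_{1..n}.
  by apply/mnmP => i; rewrite !mnmE.
case: c c0 cn => // c _ cn; rewrite big_cons IHs // (fps_var_ord R (Ordinal cn)).
have -> : fpsX (Ordinal cn) = fps_monom U_(Ordinal cn) by [].
rewrite -fps_monomD; congr fps_monom; apply/mnmP => i.
by rewrite mnmDE !mnmE eqSS.
Qed.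

End Regular.

(** * Comparison of the two sides and infinitely many variables *)

Lemma grothn_branch (R : comNzRingType) (al be : R) n la :
  sorted geq la -> (size la <= n)%N ->
  grothn al be la n = branch (fpsC al + fpsC be) (@fps_yvar n R al) n la.
Proof.
move=> sla sz; apply: fps_exdiv_unique (branch_groth_mx al be sla sz).
exact: prod_fpsXB_reg.
Qed.

Lemma HT_pos la T : HT la T -> all (leq 1) (hv_entries T).
Proof.
case/and3P=> _ hT _; rewrite /hv_entries !all_flatten; rewrite all_flatten in hT.
apply: sub_all hT => r; apply: sub_all => h /and3P[_ _].
by rewrite all_flatten.
Qed.

Lemma hv_monomE la T k : HT la T -> hv_monom T k = count_mem k.+1 (hv_entries T).
Proof.
move=> hT; rewrite /hv_monom fsfun_fun; case: ifP => // /negbT kn.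
apply/esym/count_memPn; apply: contra kn => kT.
by apply/imfsetP; exists k.+1.
Qed.

Lemma imonom_ofE n (m : 'X_{1..n}) k :
  imonom_of m k = if insub k is Some i then m i else 0%N.
Proof.
rewrite /imonom_of fsfun_fun in_fset /= mem_iota add0n /=.
case: insubP => [i -> <-|/negPf-> //]; by rewrite (mnm_nth 0).
Qed.

Lemma tab_term_hv_term (R : comNzRingType) (al be : R) n la T m :
  HT la T -> all (leq^~ n) (hv_entries T) ->
  tab_term (fpsC al) (fpsC be) (@fps_var n R) T m = hv_term al be T (imonom_of m).
Proof.
move=> hT bT; have pT := HT_pos hT; rewrite /tab_term -big_flatten /= /hook_term !big_split /=.
rewrite !prodrXr -!fpsC_exp -fpsC_mul fpsCM.
under [X in X m]eq_bigr do rewrite big_flatten.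
rewrite -big_flatten -big_flatten /= -/(hv_entries T) prod_fps_var; last first.
  by apply/allP => c cT; rewrite (allP pT) // (allP bT).
rewrite /fps_monom /hv_term -/(hv_weight al be T).
have -> : (imonom_of m == hv_monom T) =
    (m == [multinom count_mem i.+1 (hv_entries T) | i < n]).
  apply/eqP/eqP => [e|->].
    apply/mnmP => i; rewrite mnmE -(hv_monomE _ hT) -e imonom_ofE.
    by rewrite valK.
  apply/fsfunP => k; rewrite imonom_ofE (hv_monomE _ hT).
  case: insubP => [i _ <-|]; first by rewrite mnmE.
  rewrite -leqNgt => nk; apply/esym/count_memPn; apply/negP => /(allP bT).
  by rewrite leqNgt ltnS nk.
by case: eqP; rewrite ?mulr1 ?mulr0.
Qed.

(** A letter c > n puts x_c into the monomial of T, while m involves only the first n variables. *)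
Lemma hv_term_eq0 (R : comNzRingType) (al be : R) n la T (m : 'X_{1..n}) :
  HT la T -> ~~ all (leq^~ n) (hv_entries T) -> hv_term al be T (imonom_of m) = 0.
Proof.
move=> hT /allPn[c cT]; rewrite -ltnNge => nc; rewrite /hv_term.
case: eqP => // /(congr1 (fun f : imonom => f c.-1)).
rewrite imonom_ofE (hv_monomE _ hT) prednK ?(leq_trans _ nc) //.
rewrite insubF; last by apply/negbTE; rewrite -leqNgt -ltnS prednK // (leq_trans _ nc).
by move/esym/count_memPn; rewrite cT.
Qed.

(** The list comes from [has_sum_tab_ok] truncated just above the degree of m; it serves both
    summability and the value of the sum. *)
Lemma hv_term_support (R : comNzRingType) (al be : R) n la (m : 'X_{1..n}) :
  exists s : seq hvtab, [/\ uniq s, [set` s] `<=` HT la,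
    forall T, HT la T -> T \notin s -> hv_term al be T (imonom_of m) = 0
  & \sum_(T <- s) hv_term al be T (imonom_of m) =
    branch (fpsC al + fpsC be) (@fps_yvar n R al) n la m].
Proof.
have [s [us sA As es]] := has_sum_tab_ok n al be n la (mdeg m).+1.
have sH T : T \in s -> HT la T /\ all (leq^~ n) (hv_entries T).
  by move=> /sA ?; apply/HT_tab_ok.
exists s; split=> //; first by move=> T /sH[].
  move=> T hT Ts; have [bT|nb] := boolP (all (leq^~ n) (hv_entries T));
    last exact: hv_term_eq0 hT nb.
  by rewrite -(tab_term_hv_term al be m hT bT) As //; apply/HT_tab_ok.
rewrite -es // fps_sumE; apply: eq_big_seq => T /sH[hT bT].
by rewrite (tab_term_hv_term al be m hT bT).
Qed.

(** The lower bound N leaves room to require n >= size la, from where the determinants are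
    stable. *)
Lemma imonom_surj (u : imonom) N : exists n (m : 'X_{1..n}),
  [/\ (0 < n)%N, (N <= n)%N & imonom_of m = u].
Proof.
pose n := (maxn N (\max_(k <- finsupp u) k)).+1.
exists n, [multinom u i | i < n]; split=> //; first by rewrite /n; lia.
apply/fsfunP => k; rewrite imonom_ofE; case: insubP => [i _ <-|]; first by rewrite mnmE.
rewrite -leqNgt => nk; apply/esym/fsfun_dflt; apply/negP => ku.
have : (k <= \max_(k <- finsupp u) k)%N by apply: leq_bigmax_seq.
by move: nk; rewrite /n; lia.
Qed.

Theorem theorem4p2 (la : seq nat) (hla : is_partition la) :
  ifps_summable (HT la) (hv_term alpha beta) /\
  groth alpha beta la = ifps_sum (HT la) (hv_term alpha beta).
Proof.
have /andP[sla _] := hla; split.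
  move=> u; have [n [m [_ _ <-]]] := imonom_surj u 0.
  have [s [_ _ hs _]] := hv_term_support alpha beta la m.
  apply: (@sub_finite_set _ _ [set` s]); last exact: finite_seq.
  move=> T [hT nz] /=; apply/negPn/negP => Ts.
  by move: nz; rewrite hs ?eqxx.
have hrestr n : (0 < n)%N -> (size la <= n)%N ->
    ifps_restrict n (ifps_sum (HT la) (hv_term alpha beta)) = grothn alpha beta la n.
  move=> n0 sz; rewrite grothn_branch //; apply/funext => m.
  have [s [us sH hs <-]] := hv_term_support alpha beta la m.
  rewrite /ifps_restrict /ifps_sum (fsbigE s) // big_seq_cond [RHS]big_seq.
  apply: eq_bigl => T; case: (boolP (T \in s)) => //= Ts.
  by apply/mem_set/sH.
(* A series with the prescribed restrictions is unique, because each monomial is visible in the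
   restriction to some large enough n. *)
apply: xget_unique => // F hF; apply/funext => u.
have [n [m [n0 sz <-]]] := imonom_surj u (size la).
by have := congr1 (fun f => f m) (etrans (hF n n0 sz) (esym (hrestr n n0 sz))).
Qed.
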